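(* Let $(M,g)$ be a Riemannian manifold (possibly infinite-dimensional), and let $f:M\to\mathbb{R}$ be a lower semicontinuous function. Assume that there exists a constant $K>0$ such that $\|\zeta\|_{p}\leq K$ for all $\zeta\in D^{-}f(p)$ and $p\in M$. Then $$|f(p)-f(q)|\leq K\, d_{M}(p,q)\quad\text{for all } p,q\in M.$$
   Context: A Riemannian manifold is a $C^\infty$ manifold modelled on a Hilbert space (possibly infinite-dimensional) with a $C^\infty$ assignment of scalar products on the tangent spaces $TM_p$ inducing equivalent norms $\|\cdot\|_p$. $d_M$ is the Riemannian distance (infimum of lengths of $C^1$ paths joining the points). The subdifferential $D^{-}f(p)\subset T^*M_p$ is the set of all $d\varphi(p)$ with $\varphi\in C^1(M,\mathbb{R})$ such that $f-\varphi$ attains a local minimum at $p$ (it may be empty), and $\|\zeta\|_p=\sup\{|\zeta(h)|:h\in TM_p,\|h\|_p=1\}$. *)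

(* Defs.v *)
From HB Require Import structures.
From mathcomp Require Import all_boot all_order all_algebra.
From mathcomp Require Import all_classical all_reals all_analysis.
Set Implicit Arguments.
Unset Strict Implicit.
Unset Printing Implicit Defensive.
Import Order.TTheory GRing.Theory Num.Theory.
Import numFieldNormedType.Exports.
Local Open Scope classical_set_scope.
Local Open Scope ring_scope.

Definition hilbertian (R : realType) (H : normedModType R) : Prop :=
  exists ip : H -> H -> R,
    [/\ forall v w, ip v w = ip w v,
        forall w, scalar (ip ^~ w)
      & forall v, ip v v = `|v| ^+ 2].

(* A map from E to the space L^m(E; F) of bounded m-linear maps, with its
   operator norm, is encoded uncurried as A : E -> seq E -> F; the value of
   A x only matters on lists of length m.  The Frechet derivative of A, with
   values in L(E, L^m(E; F)) = L^(m+1)(E; F), is encoded by mderiv A, the new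
   argument being the head of the list. *)
Section CkMaps.
Variables (R : realType) (E F : normedModType R).
Implicit Types (U : set E) (A : E -> seq E -> F) (m k : nat).

Definition mbounded m (B : seq E -> F) (C : R) : Prop :=
  forall s, size s = m -> `|B s| <= C * \prod_(h <- s) `|h|.

Definition mcontinuous_at m A (x : E) : Prop :=
  forall e : R, 0 < e ->
    \forall y \near x, mbounded m (fun s => A y s - A x s) e.

Definition mderiv A (x : E) (s : seq E) : F :=
  if s is h :: s' then 'd (A ^~ s') x h else 0.

Definition mdifferentiable_at m A (x : E) : Prop :=
  [/\ forall s, size s = m -> differentiable (A ^~ s) x,
      exists C : R, mbounded m.+1 (mderiv A x) C
    & forall e : R, 0 < e -> \forall y \near x,
        mbounded m (fun s => A y s - A x s - mderiv A x (y - x :: s))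
                   (e * `|y - x|)].

Fixpoint mCk k m U A : Prop :=
  match k with
  | 0 => forall x, U x -> mcontinuous_at m A x
  | k'.+1 => (forall x, U x -> mdifferentiable_at m A x) /\
             mCk k' m.+1 U (mderiv A)
  end.

Definition Ck k U (f : E -> F) : Prop := mCk k 0 U (fun x _ => f x).

Definition smooth U (f : E -> F) : Prop := forall k, Ck k U f.

End CkMaps.

Record chart (R : realType) (H : normedModType R) (M : topologicalType) :=
  Chart {
    chart_dom : set M;
    chart_cod : set H;
    chart_map : M -> H;
    chart_inv : H -> M;
    chart_dom_open : open chart_dom;
    chart_cod_open : open chart_cod;
    chart_map_cod : forall p, chart_dom p -> chart_cod (chart_map p);
    chart_inv_dom : forall y, chart_cod y -> chart_dom (chart_inv y);
    chart_mapK : forall p, chart_dom p -> chart_inv (chart_map p) = p;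
    chart_invK : forall y, chart_cod y -> chart_map (chart_inv y) = y;
    chart_map_continuous : {in chart_dom, continuous chart_map};
    chart_inv_continuous : {in chart_cod, continuous chart_inv} }.

(* Smooth structure modelled on H, with a preferred chart around each point;
   the preferred charts only serve to represent tangent vectors. *)
Record smooth_structure (R : realType) (H : normedModType R)
    (M : topologicalType) := SmoothStructure {
  atlas : set (chart H M);
  transition_smooth : forall c c', atlas c -> atlas c' ->
    smooth (chart_cod c `&` chart_inv c @^-1` chart_dom c')
           (chart_map c' \o chart_inv c);
  chart_at : M -> chart H M;
  chart_at_atlas : forall p, atlas (chart_at p);
  chart_at_dom : forall p, chart_dom (chart_at p) p }.

(* A tangent vector at p is represented by its coordinates in the chart
   chart_at p, which identifies the tangent space at p with H. *)
Definition tangent (R : realType) (H : normedModType R) (M : topologicalType)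
  (X : smooth_structure H M) (p : M) : normedModType R := H.

Section RiemannianManifold.
Variables (R : realType) (H : completeNormedModType R) (M : topologicalType).
Variable X : smooth_structure H M.

(* The tangent vector at chart_inv c y with coordinates v in the chart c. *)
Definition tangent_of_chart (c : chart H M) (y v : H) :
    tangent X (chart_inv c y) :=
  'd (chart_map (chart_at X (chart_inv c y)) \o chart_inv c) y v.

Record riemannian_metric := RiemannianMetric {
  rmetric : forall p, tangent X p -> tangent X p -> R;
  rmetric_sym : forall p v w, @rmetric p v w = @rmetric p w v;
  rmetric_linear : forall p w, scalar (@rmetric p ^~ w);
  rmetric_pos : forall p (v : tangent X p), v != 0 -> 0 < @rmetric p v v;
  rmetric_equiv : forall p, exists a b : R, 0 < a /\
    forall v : tangent X p,
      a * `|v| <= Num.sqrt (@rmetric p v v) <= b * `|v|;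
  rmetric_smooth : forall c, atlas X c -> forall k,
    mCk k 2 (chart_cod c) (fun (y : H) (s : seq H) =>
      rmetric (tangent_of_chart c y (nth 0 s 0%N))
              (tangent_of_chart c y (nth 0 s 1%N)) : R) }.

Variable g : riemannian_metric.

Definition tnorm (p : M) (v : tangent X p) : R := Num.sqrt (rmetric g v v).

(* Difference quotients are restricted to [0, 1], hence one-sided at the
   endpoints. *)
Definition unit_quotient (u : R -> H) (t : R) : set_system H :=
  (fun s => (s - t)^-1 *: (u s - u t)) @ within `[0, 1] t^'.

Definition C1_path (gamma : R -> M) : Prop :=
  {within `[0, 1], continuous gamma} /\
  forall c, atlas X c -> exists w : R -> H,
    let I := `[0, 1] `&` gamma @^-1` chart_dom c in
    (forall t, I t -> unit_quotient (chart_map c \o gamma) t --> w t) /\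
    {within I, continuous w}.

Definition velocity (gamma : R -> M) (t : R) : tangent X (gamma t) :=
  lim (unit_quotient (chart_map (chart_at X (gamma t)) \o gamma) t).

Definition path_length (gamma : R -> M) : \bar R :=
  (\int[lebesgue_measure]_(t in `[0%R, 1%R]) (tnorm (velocity gamma t))%:E)%E.

(* The value is +oo when no C^1 path joins p to q. *)
Definition riemannian_dist (p q : M) : \bar R :=
  ereal_inf [set path_length gamma | gamma in
    [set gamma : R -> M | [/\ C1_path gamma, gamma 0 = p & gamma 1 = q]]].

Definition C1_function (phi : M -> R) : Prop :=
  forall c, atlas X c -> Ck 1 (chart_cod c) (phi \o chart_inv c : H -> R).

Definition differential (phi : M -> R) (p : M) : tangent X p -> R :=
  'd (phi \o chart_inv (chart_at X p) : H -> R) (chart_map (chart_at X p) p).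

Arguments differential : clear implicits.

Definition subdifferential (f : M -> R) (p : M) : set (tangent X p -> R) :=
  [set zeta | exists phi : M -> R,
    [/\ C1_function phi,
        \forall q \near p, f p - phi p <= f q - phi q
      & zeta = differential phi p]].

(* The supremum is taken in the extended reals, so it needs no proof that the
   covector is bounded. *)
Definition conorm (p : M) (zeta : tangent X p -> R) : \bar R :=
  ereal_sup [set `|zeta h|%:E | h in [set h : tangent X p | tnorm h = 1]].

End RiemannianManifold.

Arguments subdifferential {R H M} X f p _.

(* Main.v *)
Require Import Defs.
From HB Require Import structures.
From mathcomp Require Import all_boot all_order all_algebra.
From mathcomp Require Import ring lra.
From mathcomp Require Import all_classical all_reals all_analysis.
From mathcomp Require Import measurable_realfun.
Set Implicit Arguments.
Unset Strict Implicit.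
Unset Printing Implicit Defensive.
Import Order.TTheory GRing.Theory Num.Theory.
Import numFieldNormedType.Exports.
Local Open Scope classical_set_scope.
Local Open Scope ring_scope.

(** Why the theorem holds.

    Around a point p, the preferred chart c identifies the tangent space at p
    with H, and the scalar product g_p is an inner product B on H whose norm N
    is equivalent to the given one, hence complete.  The heart of the proof is
    a pointwise estimate at p, [chart_lipschitz]: for every K' > K there is C
    such that, for x near x0 = c p and F = f o c^-1,
      |F x - F x0| <= K' N(x - x0) + C N(x - x0)^2.

    It comes from a minimization argument in H, [local_lipschitz].  Fix x near
    x0 and minimize Phi y = F y + K' N(y - x) + C N(y - x)^2 on a closed N-ball
    around x.  Closed balls of H need not be compact, but the principle of
    Borwein and Preiss, [smooth_variational_principle], perturbs Phi by a small
    quadratic function so that a minimizer y exists.  If y differs from x and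
    lies inside the ball, then F has at y a quadratic minorant whose slope in
    the direction y - x exceeds K in absolute value; the bound on
    subgradients excludes this.  If C is large in terms of F x, then y is not
    on the boundary either.  So y = x, and letting the perturbation vanish
    yields F x <= F y + K' N(y - x) + C N(y - x)^2 on the ball.  Comparing with
    x0 then bounds F x itself near x0, so that C can be chosen uniformly and
    the roles of x and x0 can be exchanged.

    A quadratic minorant of F at x gives an element of the subdifferential of f
    only after it has been replaced by a C^1 function on the whole of M,
    [proximal_bound].  The function max(0, 1 + u)^2 / 2, with u a concave
    quadratic function, is tangent to the minorant at x and vanishes off a
    small ball; it is transported to M and extended by 0.  For the extension
    to be C^1, the image in M of a small closed ball of the chart has to be
    closed, [closed_chart_image].  Without compactness this is a consequence
    of the metric: a short segment of another chart has a short image in c, so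
    its trace in c is Cauchy and, M being Hausdorff, cannot leave the chart.

    Along a C^1 path gamma, the pointwise estimate becomes
      |f(gamma s) - f(gamma t)| <= (K |gamma'(t)| + e) |s - t|
    for s near t, [path_dini].  The speed of gamma is continuous, and chaining
    these local inequalities along [0, 1] ([interval_chain]) bounds
    |f(gamma 1) - f(gamma 0)| by K times the length of gamma; it remains to
    take the infimum over the paths from p to q. *)

(** * Chaining along an interval, geometric convergence *)

(** The supremum of the points that can be reached from a can itself be
    reached, by the condition on its left, and it is b, by the condition on its
    right.  This plays the part of compactness of [a, b] whenever a local
    inequality has to be summed up. *)
Lemma interval_chain (R : realType) (P : R -> R -> Prop) (a b : R) :
  a <= b ->
  (forall x y z, a <= x -> x <= y -> y <= z -> z <= b ->
     P x y -> P y z -> P x z) ->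
  (forall t, a <= t <= b -> \forall s \near t,
     (a <= s <= t -> P s t) /\ (t <= s <= b -> P t s)) ->
  P a b.
Proof.
move=> ab Ptrans Ploc.
pose S := [set t | a <= t <= b /\ P a t].
have Sa : S a.
  split; first by rewrite lexx.
  have /Ploc/nbhs_singleton[+ _] : a <= a <= b by rewrite lexx.
  by apply; rewrite lexx.
have Sub : ubound S b by move=> t [/andP[]].
have Shas : has_sup S by split; [exists a | exists b].
set c := sup S.
have ac : a <= c by exact: ub_le_sup Shas.2 _ Sa.
have cb : c <= b by apply: ge_sup => //; exists a.
have /Ploc/nbhs_ballP[e /= e0 ce] : a <= c <= b by rewrite ac cb.
have Pac : P a c.
  have [t [/andP[at_ tb] Pat] tc] := sup_adherent e0 Shas.
  have {}tc : c - e < t by [].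
  have tlec : t <= c by apply: ub_le_sup Shas.2 _ _; split => //; apply/andP.
  have : ball c e t by rewrite /ball /= ltr_distlC; apply/andP; split; lra.
  move=> /ce[+ _]; rewrite at_ tlec => /(_ isT).
  by apply: Ptrans Pat => //.
have [->//|cltb] : b = c \/ c < b by move: cb; rewrite le_eqVlt => /orP[/eqP|]; auto.
pose s := Num.min (c + e / 2) b.
have cs : c < s by rewrite /s lt_min; apply/andP; split => //; lra.
have sb : s <= b by rewrite /s ge_min lexx orbT.
have : ball c e s.
  have : s <= c + e / 2 by rewrite /s ge_min lexx.
  by move=> ?; rewrite /ball /= ltr_distlC; apply/andP; split; lra.
move=> /ce[_]; rewrite (ltW cs) sb => /(_ isT) Pcs.
suff : s <= c by rewrite leNgt cs.
apply: ub_le_sup Shas.2 _ _; split; first by rewrite sb (le_trans ac) // ltW.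
by apply: Ptrans Pac Pcs => //; exact: ltW.
Qed.

Lemma geometric_cvgn (R : realType) (V : completeNormedModType R)
    (u : nat -> V) (C : R) :
  (forall n, `|u n.+1 - u n| <= C * 2^-1 ^+ n) -> cvgn u.
Proof.
move=> hu.
have : cvgn (series (telescope u)).
  apply: normed_cvg; apply: (@series_le_cvg _ _ (geometric C 2^-1)).
  - by move=> n; exact: normr_ge0.
  - by move=> n; apply: le_trans (hu n).
  - exact: hu.
  - by apply: is_cvg_geometric_series; rewrite ger0_norm // invf_lt1 // ltr1n.
rewrite telescopeK => /(is_cvgD (is_cvg_cst (u 0%N) (F := \oo))).
by congr (cvgn _); apply/funext => n /=; rewrite addrC subrK.
Qed.

(** * Inner products with an equivalent norm *)

(** The scalar product of a tangent space, read in a chart, has this form. *)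
Definition equivalent_form (R : realType) (H : normedModType R)
    (B : H -> H -> R) (a b : R) :=
  [/\ forall v w, B v w = B w v, forall w, scalar (B ^~ w), 0 < a, 0 < b
    & forall v, a * `|v| <= Num.sqrt (B v v) <= b * `|v|].

Section InnerProduct.
Variables (R : realType) (H : completeNormedModType R).
Variables (B : H -> H -> R) (a b : R).
Hypothesis hB : equivalent_form B a b.

Let Bsym : forall v w, B v w = B w v. Proof. by case: hB. Qed.
Let Blin : forall w, scalar (B ^~ w). Proof. by case: hB. Qed.
Let a_gt0 : 0 < a. Proof. by case: hB. Qed.
Let b_gt0 : 0 < b. Proof. by case: hB. Qed.
Let Beq : forall v, a * `|v| <= Num.sqrt (B v v) <= b * `|v|.
Proof. by case: hB. Qed.

Definition inorm (v : H) : R := Num.sqrt (B v v).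
Local Notation N := inorm.

Lemma form_lin (k : R) u v w : B (k *: u + v) w = k * B u w + B v w.
Proof. exact: Blin. Qed.

Lemma formDl u v w : B (u + v) w = B u w + B v w.
Proof. by rewrite -[u in LHS]scale1r form_lin mul1r. Qed.

Lemma form0l w : B 0 w = 0.
Proof. by apply: (@addrI _ (B 0 w)); rewrite -formDl !addr0. Qed.

Lemma formZl k u w : B (k *: u) w = k * B u w.
Proof. by rewrite -[k *: u]addr0 form_lin form0l addr0. Qed.

Lemma formNl u w : B (- u) w = - B u w.
Proof. by rewrite -scaleN1r formZl mulN1r. Qed.

Lemma formDr u v w : B w (u + v) = B w u + B w v.
Proof. by rewrite !(Bsym w) formDl. Qed.

Lemma formZr k u w : B w (k *: u) = k * B w u.
Proof. by rewrite !(Bsym w) formZl. Qed.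

Lemma formNr u w : B w (- u) = - B w u.
Proof. by rewrite !(Bsym w) formNl. Qed.

Definition formE := (formDl, formDr, formNl, formNr, formZl, formZr).

Lemma form_ge0 v : 0 <= B v v.
Proof.
have [->|v0] := eqVneq v 0; first by rewrite form0l.
rewrite leNgt; apply/negP => /ltW/ler0_sqrtr Bv.
have /andP[+ _] := Beq v; rewrite Bv; apply/negP; rewrite -ltNge.
by rewrite mulr_gt0 // normr_gt0.
Qed.

Lemma inorm_ge0 v : 0 <= N v. Proof. exact: sqrtr_ge0. Qed.

Lemma sqr_inorm v : N v ^+ 2 = B v v.
Proof. by rewrite sqr_sqrtr // form_ge0. Qed.

Lemma inorm_lower v : a * `|v| <= N v. Proof. by have /andP[] := Beq v. Qed.

Lemma inorm_upper v : N v <= b * `|v|. Proof. by have /andP[] := Beq v. Qed.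

Lemma inorm_gt0 v : v != 0 -> 0 < N v.
Proof. by move=> v0; apply: lt_le_trans (inorm_lower v); rewrite mulr_gt0 ?normr_gt0. Qed.

Lemma inormN v : N (- v) = N v.
Proof. by rewrite /N !formE opprK. Qed.

Lemma inorm_distC u v : N (u - v) = N (v - u).
Proof. by rewrite -inormN opprB. Qed.

Lemma inorm0 : N 0 = 0. Proof. by rewrite /N form0l sqrtr0. Qed.

(** Cauchy-Schwarz, from the positivity of B at N v *: u - N u *: v. *)
Lemma form_le_inorm u v : B u v <= N u * N v.
Proof.
have [->|v0] := eqVneq v 0.
  by rewrite Bsym form0l mulr_ge0 // inorm_ge0.
have Nv := inorm_gt0 v0.
have [->|u0] := eqVneq u 0; first by rewrite form0l mulr_ge0 // inorm_ge0.
have Nu := inorm_gt0 u0.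
have := form_ge0 (N v *: u - N u *: v).
rewrite !formE -!sqr_inorm (Bsym v u) => h.
have : 0 <= (2 * (N u * N v)) * (N u * N v - B u v) by nra.
by rewrite pmulr_rge0 ?subr_ge0 // !mulr_gt0.
Qed.

Lemma abs_form_le u v : `|B u v| <= N u * N v.
Proof.
rewrite ler_norml form_le_inorm andbT lerNl -formNl.
by rewrite (le_trans (form_le_inorm _ _)) // inormN.
Qed.

Lemma inormD u v : N (u + v) <= N u + N v.
Proof.
rewrite -(@ler_pXn2r _ 2%N) ?nnegrE ?inorm_ge0 ?addr_ge0 ?inorm_ge0 //.
rewrite sqr_inorm !formE (Bsym v u) sqrrD !sqr_inorm.
have := form_le_inorm u v; lra.
Qed.

Lemma inormZ k v : N (k *: v) = `|k| * N v.
Proof.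
by rewrite /N !formE mulrA -expr2 sqrtrM ?sqr_ge0 // sqrtr_sqr.
Qed.

Lemma abs_form_le_norm u v : `|B u v| <= b ^+ 2 * `|u| * `|v|.
Proof.
apply: le_trans (abs_form_le u v) _.
rewrite (_ : b ^+ 2 * _ * _ = (b * `|u|) * (b * `|v|)); last by ring.
by apply: ler_pM; rewrite ?inorm_ge0 ?inorm_upper.
Qed.

Lemma inorm_continuous : continuous N.
Proof.
move=> u; apply/cvgrPdist_le => e e0.
have d0 : 0 < e / b by rewrite divr_gt0.
near=> v.
have uv : N (u - v) <= e.
  apply: le_trans (inorm_upper _) _; rewrite -ler_pdivlMl // mulrC.
  by near: v; apply: cvgr_dist_le.
rewrite ler_norml; apply/andP; split.
  by have := inormD (v - u) u; rewrite subrK inorm_distC => h; lra.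
by have := inormD (u - v) v; rewrite subrK => h; lra.
Unshelve. all: by end_near. Qed.

Lemma inorm_cvg (T : Type) (F : set_system T) {FF : Filter F} (u : T -> H) u0 :
  u @ F --> u0 -> (fun t => N (u t)) @ F --> N u0.
Proof. by move=> /cvg_comp; apply; exact: inorm_continuous. Qed.

Lemma inorm_dist_cvg x y : (fun z => N (z - x)) @ y --> N (y - x).
Proof. by apply: inorm_cvg; apply: cvgB; [exact: cvg_id | exact: cvg_cst]. Qed.

(** Polarization reduces the joint continuity of B to that of N. *)
Lemma form_cvg (T : Type) (F : set_system T) {FF : Filter F} (u v : T -> H)
    (u0 v0 : H) :
  u @ F --> u0 -> v @ F --> v0 -> (fun t => B (u t) (v t)) @ F --> B u0 v0.
Proof.
move=> uu0 vv0.
have polar x y : B x y = 4^-1 * (N (x + y) ^+ 2 - N (x - y) ^+ 2).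
  by rewrite !sqr_inorm !formE (Bsym y x); field.
have Ncvg (w : T -> H) w0 : w @ F --> w0 ->
    (fun t => N (w t) ^+ 2) @ F --> N w0 ^+ 2.
  move=> /inorm_cvg h.
  under eq_fun do rewrite expr2.
  by rewrite expr2; apply: cvgM.
under eq_fun do rewrite polar.
rewrite polar; apply: cvgMr; apply: cvgB; apply: Ncvg; first exact: cvgD.
exact: cvgB.
Qed.

(** * The smooth variational principle of Borwein and Preiss *)

Section VariationalPrinciple.
Variables (D : set H) (Phi : H -> R) (m M e : R).
Hypothesis D_closed : closed D.
Hypothesis D_neq0 : D !=set0.
Hypothesis D_bounded : forall y, D y -> N y <= M.
Hypothesis Phi_ge : forall y, D y -> m <= Phi y.
Hypothesis Phi_lsc :
  forall y, D y -> forall d : R, 0 < d -> \forall y' \near y, Phi y - d < Phi y'.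
Hypothesis e_gt0 : 0 < e.

(* Stage n adds the penalty wt n * N (y - y_ n) ^+ 2, where y_ n minimizes up
   to tol n the function obtained so far.  A sum of such penalties is a single
   quadratic function: up to a constant it is wt_sum n * B y y - 2 * B w y,
   with w the sum of the wt i *: y_ i for i < n.  So pen only has to remember
   the vector w.  The ratio tol n / wt n is a geometric sequence, and so is
   the bound that it yields on the steps of y_. *)
Let wt n : R := e * 2^-1 ^+ n.
Let tol n : R := wt n * (2^-1 ^+ n) ^+ 2.
Let wt_sum n : R := 2 * e - 2 * wt n.

Let pen n (w y : H) := Phi y + wt_sum n * B y y - 2 * B w y.

Let wt_gt0 n : 0 < wt n.
Proof. by rewrite mulr_gt0 // exprn_gt0. Qed.

Let tol_gt0 n : 0 < tol n.
Proof. by rewrite mulr_gt0 // !exprn_gt0. Qed.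

Let wtS n : wt n = 2 * wt n.+1.
Proof. by rewrite /wt exprS; field. Qed.

Let wt_sumS n : wt_sum n.+1 = wt_sum n + wt n.
Proof. by rewrite /wt_sum (wtS n); ring. Qed.

Let wt_le n : wt n <= e.
Proof. by rewrite /wt ger_pMr // exprn_ile1 // invf_le1 // ler1n. Qed.

Let wt_sum_ge0 n : 0 <= wt_sum n.
Proof. by rewrite /wt_sum; have := wt_le n; lra. Qed.

Let almost_min n w : exists y, D y /\
  forall y', D y' -> pen n w y <= pen n w y' + tol n.
Proof.
have [y0 Dy0] := D_neq0.
have hi : has_inf (pen n w @` D).
  split; first by exists (pen n w y0); exists y0.
  exists (m - 2 * (N w * M)) => _ [y Dy <-]; rewrite /pen.
  have := Phi_ge Dy; have := mulr_ge0 (wt_sum_ge0 n) (form_ge0 y).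
  have := form_le_inorm w y; have := D_bounded Dy; have := inorm_ge0 w.
  move=> w0 yM wy h1 h2.
  have : N w * N y <= N w * M by rewrite ler_wpM2l.
  lra.
have [_ [y Dy <-] hy] := inf_adherent (tol_gt0 n) hi.
exists y; split => // y' Dy'; apply: ltW; apply: lt_le_trans hy _.
by rewrite lerD2r; apply: ge_inf hi.2 _ _; exists y'.
Qed.

Let pick n w : H := projT1 (cid (almost_min n w)).
Let pickD n w : D (pick n w).
Proof. by rewrite /pick; case: cid => y []. Qed.
Let pick_min n w y' : D y' -> pen n w (pick n w) <= pen n w y' + tol n.
Proof. by rewrite /pick; case: cid => y [_ h] /=; exact: h. Qed.

Let w_ : nat -> H :=
  fix w n := if n is n'.+1 then w n' + wt n' *: pick n' (w n') else 0.
Let y_ n := pick n (w_ n).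

Let w_S n : w_ n.+1 = w_ n + wt n *: y_ n. Proof. by []. Qed.

Let y_step n : `|y_ n.+1 - y_ n| <= 2 / a * 2^-1 ^+ n.
Proof.
set z := y_ n.+1 - y_ n.
have h1 := pick_min n (w_ n) (pickD n.+1 (w_ n.+1)).
have h2 := pick_min n.+1 (w_ n.+1) (pickD n (w_ n)).
have h : wt n * N z ^+ 2 <= tol n + tol n.+1.
  rewrite sqr_inorm /z !formE (Bsym (y_ n.+1) (y_ n)).
  move: h1 h2; rewrite /pen w_S wt_sumS !formE -/(y_ n) -/(y_ n.+1); lra.
have p2 : 0 < (2^-1 : R) ^+ n by rewrite exprn_gt0.
have tolS : tol n = 8 * tol n.+1.
  by rewrite /tol (wtS n) (exprS _ n); field.
have Nz : N z ^+ 2 <= (2 * 2^-1 ^+ n) ^+ 2.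
  have : wt n * N z ^+ 2 <= wt n * (2 * 2^-1 ^+ n) ^+ 2.
    have := tol_gt0 n; rewrite exprMn; move: h; rewrite tolS.
    by rewrite {1}/tol in tolS; rewrite [in X in _ -> _ -> X]mulrCA; lra.
  by rewrite ler_pM2l.
have {}Nz : N z <= 2 * 2^-1 ^+ n.
  by rewrite -(@ler_pXn2r _ 2%N) // nnegrE ?inorm_ge0 // mulr_ge0 // ltW.
have := le_trans (inorm_lower z) Nz.
by rewrite mulrC -ler_pdivlMr // mulrAC.
Qed.

Let y_cvg : cvgn y_. Proof. exact: geometric_cvgn y_step. Qed.

Let y_lim := lim (y_ @ \oo).

Let Dy_lim : D y_lim.
Proof.
apply: (@closed_cvg _ _ \oo _ y_ D D_closed _ y_lim y_cvg).
by apply: nearW => n; exact: pickD.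
Qed.

Let w_cvg : cvgn w_.
Proof.
apply: (@geometric_cvgn _ _ _ (e * (M / a))) => n.
rewrite w_S addrAC subrr add0r normrZ gtr0_norm // /wt [leRHS]mulrAC.
rewrite (ler_wpM2l (ltW (wt_gt0 n))) // ler_pdivlMr // mulrC.
exact: le_trans (inorm_lower _) (D_bounded (pickD _ _)).
Qed.

Let w_lim := lim (w_ @ \oo).

Let wt_cvg : wt @ \oo --> (0 : R).
Proof. by apply: cvg_geometric; rewrite ger0_norm // invf_lt1 // ltr1n. Qed.

Let Nw n : N (w_ n) <= 2 * e * M.
Proof.
suff : N (w_ n) <= wt_sum n * M.
  move=> /le_trans; apply; rewrite ler_wpM2r //.
    have [y Dy] := D_neq0; exact: le_trans (inorm_ge0 y) (D_bounded Dy).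
  by rewrite /wt_sum; have := wt_gt0 n; lra.
elim: n => [|n IH]; first by rewrite /= inorm0 /wt_sum /wt expr0 mulr1 subrr mul0r.
rewrite w_S wt_sumS; apply: le_trans (inormD _ _) _.
rewrite mulrDl lerD // inormZ gtr0_norm // (ler_wpM2l (ltW (wt_gt0 n))) //.
exact: D_bounded (pickD _ _).
Qed.

(** The minimizer is the limit of y_, and zeta is twice the weighted sum of the
    y_lim - y_ n: the penalties, expanded around y_lim, leave this linear term
    and a quadratic term of total weight 2 * e. *)
Lemma smooth_variational_principle : exists y zeta : H,
  [/\ D y, N zeta <= 8 * M * e
    & forall y', D y' -> Phi y <= Phi y' + B zeta (y' - y) + 2 * e * N (y' - y) ^+ 2].
Proof.
exists y_lim, ((4 * e) *: y_lim - 2 *: w_lim); split=> // [|y' Dy'].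
  apply: le_trans (inormD _ _) _; rewrite inormN !inormZ !gtr0_norm ?mulr_gt0 //.
  have : N y_lim <= M by exact: D_bounded.
  have : N w_lim <= 2 * e * M.
    have Nw_cvg : (fun n => N (w_ n)) @ \oo --> N w_lim by exact: inorm_cvg w_cvg.
    by apply: (cvgr_to_le Nw_cvg); apply: nearW; exact: Nw.
  move=> ? /(ler_wpM2l (ltW (mulr_gt0 (ltr0n _ 4) e_gt0))); lra.
apply/ler_addgt0Pr => d d0.
have sum_cvg : wt_sum @ \oo --> 2 * e.
  rewrite -[2 * e in X in _ --> X]subr0; apply: cvgB; first exact: cvg_cst.
  by rewrite -(mulr0 2); apply: cvgMr.
pose rhs n := Phi y' + B (wt_sum n *: (y' + y_ n) - 2 *: w_ n) (y' - y_ n) + tol n + d.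
have rhs_cvg : rhs @ \oo -->
    Phi y' + B ((2 * e) *: (y' + y_lim) - 2 *: w_lim) (y' - y_lim) + 0 + d.
  apply: cvgD; last exact: cvg_cst.
  apply: cvgD; first apply: cvgD; first exact: cvg_cst.
    apply: form_cvg.
      apply: cvgB; last by apply: cvgZr.
      by apply: cvgZ => //; apply: cvgD => //; exact: cvg_cst.
    by apply: cvgB => //; exact: cvg_cst.
  have half_cvg : (fun n => (2^-1 : R) ^+ n) @ \oo --> (0 : R).
    by apply: cvg_expr; rewrite ger0_norm // invf_lt1 // ltr1n.
  rewrite -(mulr0 0); apply: cvgM => //; rewrite -(mulr0 0).
  by under eq_fun do rewrite expr2; exact: cvgM.
have : Phi y_lim <= Phi y' + B ((2 * e) *: (y' + y_lim) - 2 *: w_lim) (y' - y_lim) + 0 + d.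
  apply: (cvgr_to_ge rhs_cvg).
  have : \forall n \near \oo, Phi y_lim - d < Phi (y_ n).
    exact: (y_cvg (Phi_lsc Dy_lim d0)).
  apply: filterS => n hn.
  have := pick_min n (w_ n) Dy'; rewrite -/(y_ n) /pen.
  rewrite /rhs !formE (Bsym (y_ n) y'); move: hn; lra.
by rewrite sqr_inorm !formE (Bsym y_lim y'); lra.
Qed.

End VariationalPrinciple.

(** * From quadratic minorants to a pointwise Lipschitz estimate *)

(** The square root lies below its tangent line at N d ^+ 2.  The right-hand
    side is quadratic in w, so subtracting a multiple of N can be traded for
    subtracting a quadratic function. *)
Lemma inormD_tangent d w : d != 0 ->
  N (d + w) <= N d + B d w / N d + B w w / (2 * N d).
Proof.
move=> /inorm_gt0 d0.
have d2 : 0 < 2 * N d by rewrite mulr_gt0.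
rewrite -(ler_pM2l d2).
have -> : 2 * N d * (N d + B d w / N d + B w w / (2 * N d)) =
    2 * N d ^+ 2 + 2 * B d w + B w w by field; rewrite gt_eqF.
have : N (d + w) ^+ 2 = N d ^+ 2 + 2 * B d w + B w w.
  by rewrite !sqr_inorm !formE (Bsym w d); ring.
have := sqr_ge0 (N (d + w) - N d); rewrite sqrrB; lra.
Qed.

Lemma inorm_ball_closed x rho : closed [set y | N (y - x) <= rho].
Proof.
apply: (@closed_comp _ _ (fun y => N (y - x)) [set t | t <= rho]).
  by move=> y _; exact: inorm_dist_cvg.
exact: closed_le.
Qed.

Section LocalLipschitz.
Variables (F : H -> R) (x0 : H) (r m L L' : R).
Hypothesis r_gt0 : 0 < r.
Hypothesis F_lsc : forall y, `|y - x0| < r ->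
  forall d : R, 0 < d -> \forall y' \near y, F y - d < F y'.
Hypothesis F_ge : forall y, `|y - x0| < r -> m <= F y.
Hypothesis proximal_le : forall x v s, `|x - x0| < r ->
  (\forall w \near 0, F x + B v w - s * B w w <= F (x + w)) ->
  forall w, `|B v w| <= L * N w.
Hypothesis L_ge0 : 0 <= L.
Hypothesis LL' : L < L'.

(** If C is large enough for the penalty to outweigh F x - m on the sphere of
    radius rho, then the perturbed minimum of F + L' N + C N^2 is attained
    neither on that sphere nor at an inner point other than x, where F would
    have a quadratic minorant of slope larger than L. *)
Lemma quadratic_descent (x : H) (rho C : R) : 0 < rho ->
  (forall y, N (y - x) <= rho -> `|y - x0| < r) ->
  0 <= C -> F x - m <= C * rho ^+ 2 ->
  forall y, N (y - x) <= rho ->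
    F x <= F y + L' * N (y - x) + C * N (y - x) ^+ 2.
Proof.
move=> rho0 ball_r C0 Cm y1 Dy1; apply/ler_addgt0Pr => d d0.
have L'0 : 0 < L' by exact: le_lt_trans LL'.
pose D := [set y | N (y - x) <= rho].
pose Phi y := F y + L' * N (y - x) + C * N (y - x) ^+ 2.
pose M := N x + rho.
have M0 : 0 < M by rewrite ltr_wpDl ?inorm_ge0.
(* The size e of the perturbation is chosen so that e * Q is at most each of
   three quantities: the slack d of the conclusion, half of the gap L' - L of
   the slopes, and half of L' * rho, an amount by which the values of Phi on
   the sphere exceed its value at x. *)
pose Q := 8 * M + 8 * M * rho + 2 * rho ^+ 2 + 1.
have Mrho0 : 0 < M * rho by rewrite mulr_gt0.
have rho2 : 0 < rho ^+ 2 by rewrite exprn_gt0.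
have Q0 : 0 < Q by rewrite /Q; lra.
pose eQ := Num.min d (Num.min ((L' - L) / 2) (L' * rho / 2)).
have L'rho : 0 < L' * rho by rewrite mulr_gt0.
have eQ0 : 0 < eQ.
  by rewrite !lt_min d0 !divr_gt0 // subr_gt0.
pose e := eQ / Q.
have e0 : 0 < e by rewrite divr_gt0.
have eQE : e * Q = eQ by rewrite divfK // gt_eqF.
have eM0 : 0 < e * M by rewrite mulr_gt0.
have eMr0 : 0 < e * (M * rho) by rewrite mulr_gt0.
have er0 : 0 < e * rho ^+ 2 by rewrite mulr_gt0.
have eQ1 : eQ <= d by rewrite ge_min lexx.
have eQ2 : eQ <= (L' - L) / 2 by rewrite !ge_min lexx orbT.
have eQ3 : eQ <= L' * rho / 2 by rewrite !ge_min lexx !orbT.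
have bound_eQ : 8 * M * e * rho + 2 * e * rho ^+ 2 <= eQ.
  by move: eQE; rewrite /Q; lra.
have slope_eQ : 8 * M * e <= eQ by move: eQE; rewrite /Q; lra.
have [|||||y [zeta [Dy zeta_le minPhi]]] :=
    @smooth_variational_principle D Phi m M e _ _ _ _ _ e0.
- exact: inorm_ball_closed.
- by exists x; rewrite /D /= subrr inorm0 ltW.
- move=> y; rewrite /D /M /= => Dy; rewrite -[y](subrK x).
  by rewrite addrC; apply: le_trans (inormD _ _) _; rewrite lerD2l.
- move=> y Dy; apply: le_trans (F_ge (ball_r _ Dy)) _.
  rewrite /Phi -addrA lerDl addr_ge0 // mulr_ge0 ?inorm_ge0 ?sqr_ge0 //.
  exact: ltW.
- move=> y Dy t t0; have t2 : 0 < t / 2 by lra.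
  have cN := @inorm_dist_cvg x y.
  have : (fun y => L' * N (y - x) + C * N (y - x) ^+ 2) @ y -->
      L' * N (y - x) + C * N (y - x) ^+ 2.
    apply: cvgD; apply: cvgMr => //.
    by under eq_fun do rewrite expr2; rewrite expr2; apply: cvgM.
  move=> /cvgrPdist_lt/(_ _ t2); apply: filterS2 (F_lsc (ball_r _ Dy) t2) => z.
  by rewrite /Phi ltr_distlC => ? /andP[? _]; lra.
have zeta_form u : `|B zeta u| <= 8 * M * e * N u.
  apply: le_trans (abs_form_le _ _) _.
  by rewrite ler_wpM2r // inorm_ge0.
have gap u : N u <= rho -> B zeta u + 2 * e * N u ^+ 2 <= eQ.
  move=> Nu; apply: le_trans bound_eQ; apply: lerD.
    apply: le_trans (ler_norm _) _; apply: le_trans (zeta_form _) _.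
    by apply: ler_wpM2l => //; apply: ltW; rewrite (mulr_gt0 _ e0) // mulr_gt0.
  apply: ler_wpM2l; first by rewrite mulr_ge0 // ltW.
  by rewrite lerXn2r // nnegrE ?inorm_ge0 // ltW.
have [yx|yx] := eqVneq y x.
  have := minPhi _ Dy1; rewrite yx /Phi subrr inorm0 expr0n /= !mulr0 !addr0.
  by have := gap _ Dy1; lra.
(* The minimizer y differs from x: it is first shown to lie inside the ball,
   then the minorant of F at y contradicts proximal_le in the direction
   y - x. *)
exfalso.
have d_neq0 : y - x != 0 by rewrite subr_eq0.
have Nd0 := inorm_gt0 d_neq0.
have Nd_rho : N (y - x) < rho.
  rewrite lt_neqAle Dy andbT; apply/eqP => yrho.
  have : D x by rewrite /D /= subrr inorm0 ltW.
  move=> /minPhi; rewrite /Phi subrr inorm0 expr0n /= !mulr0 !addr0 yrho.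
  have := F_ge (ball_r _ Dy); have := @gap (x - y).
  by rewrite inorm_distC yrho lexx => /(_ isT); lra.
have [dir dirE] : exists dir, dir = y - x by exists (y - x).
rewrite -dirE in Nd0 Nd_rho d_neq0.
pose v := - (L' / N dir + 2 * C) *: dir - zeta.
pose s := L' / (2 * N dir) + C + 2 * e.
have : `|B v dir| <= L * N dir.
  apply: (proximal_le (s := s) (ball_r _ Dy)).
  have near0 : \forall w \near 0, N (dir + w) < rho.
    have c0 : (fun w => N (dir + w)) @ (0 : H) --> N (dir + 0).
      by apply: inorm_cvg; apply: cvgD; [exact: cvg_cst | exact: cvg_id].
    by rewrite addr0 in c0; apply: cvgr_lt c0 _ _.
  near=> w.
  have Nw : N (dir + w) < rho by near: w.
  have yw : y + w - x = dir + w by rewrite dirE addrAC.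
  have /minPhi : D (y + w) by rewrite /D /= yw ltW.
  rewrite /Phi yw -dirE (addrC y w) addrK (addrC w y).
  have h2 : N (dir + w) ^+ 2 = N dir ^+ 2 + 2 * B dir w + B w w.
    by rewrite !sqr_inorm !formE (Bsym w dir); ring.
  have h1 := ler_wpM2l (ltW L'0) (inormD_tangent w d_neq0).
  rewrite h2 (sqr_inorm w) /v /s !formE.
  have -> : (L' / (2 * N dir) + C + 2 * e) * B w w =
     L' * (B w w / (2 * N dir)) + C * B w w + 2 * e * B w w by ring.
  have -> : - (L' / N dir + 2 * C) * B dir w =
     - (L' * (B dir w / N dir)) - 2 * C * B dir w by ring.
  by lra.
rewrite /v !formE -sqr_inorm.
have -> : - (L' / N dir + 2 * C) * N dir ^+ 2 - B zeta dir =
    - (L' * N dir + 2 * C * N dir ^+ 2 + B zeta dir).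
  by field; rewrite gt_eqF.
rewrite normrN => /(le_trans (ler_norm _)).
have := zeta_form dir; rewrite ler_norml => /andP[+ _].
have := ler_wpM2r (ltW Nd0) (le_trans slope_eQ eQ2).
have := mulr_ge0 C0 (sqr_ge0 (N dir)).
have : 0 < (L' - L) * N dir by rewrite mulr_gt0 // subr_gt0.
lra.
Unshelve. all: by end_near. Qed.

(** In quadratic_descent the constant depends on F x.  Applied at x and
    evaluated at x0, the lemma bounds F x - m by a quarter of itself plus a
    quantity that depends on x0 only; this bound, top, makes the constant
    uniform. *)
Lemma local_lipschitz : exists C, \forall x \near x0,
  `|F x - F x0| <= L' * N (x - x0) + C * N (x - x0) ^+ 2.
Proof.
have L'0 : 0 < L' by exact: le_lt_trans LL'.
pose rho := a * r / 3.
have rho0 : 0 < rho by rewrite divr_gt0 // mulr_gt0.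
have rho2 : 0 < rho ^+ 2 by rewrite exprn_gt0.
have ball_r x y : N (x - x0) <= rho -> N (y - x) <= rho -> `|y - x0| < r.
  move=> xr yr; rewrite -(ltr_pM2l a_gt0); apply: le_lt_trans (inorm_lower _) _.
  rewrite -(subrK x y) -addrA; apply: le_lt_trans (inormD _ _) _.
  by move: xr yr; rewrite /rho; have := mulr_gt0 a_gt0 r_gt0; lra.
have x0x0 : `|x0 - x0| < r by rewrite subrr normr0.
have mF0 := F_ge x0x0.
pose top := 2 * (F x0 - m + L' * rho).
pose C := top / rho ^+ 2.
have Lr : 0 < L' * rho by rewrite mulr_gt0.
have top0 : 0 < top by rewrite /top; lra.
have C0 : 0 <= C by apply: divr_ge0; exact: ltW.
exists C.
have near_rho : \forall x \near x0, N (x - x0) <= rho / 2.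
  have c0 := @inorm_dist_cvg x0 x0.
  rewrite subrr inorm0 in c0; apply: cvgr_le c0 _ _; lra.
near=> x.
have xr2 : N (x - x0) <= rho / 2 by near: x.
have xr : N (x - x0) <= rho by lra.
have rx : N (x0 - x) <= rho by rewrite inorm_distC.
have ball_x := ball_r x ^~ xr.
have mFx : m <= F x by apply: (@F_ge x); apply: (ball_r x) => //; rewrite subrr inorm0 ltW.
have Fx_top : F x - m <= top.
  pose Cx := (F x - m) / rho ^+ 2.
  have Cx0 : 0 <= Cx by rewrite divr_ge0 ?subr_ge0 // ltW.
  have CxE : Cx * rho ^+ 2 = F x - m by rewrite divfK // gt_eqF.
  have := @quadratic_descent x rho Cx rho0 ball_x Cx0.
  rewrite CxE lexx => /(_ isT x0 rx).
  rewrite inorm_distC.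
  have : Cx * N (x - x0) ^+ 2 <= Cx * (rho / 2) ^+ 2.
    by rewrite ler_wpM2l // lerXn2r // nnegrE ?inorm_ge0 //; lra.
  have -> : Cx * (rho / 2) ^+ 2 = (F x - m) / 4 by rewrite -CxE; field.
  have : L' * N (x - x0) <= L' * (rho / 2) by rewrite ler_wpM2l // ltW.
  rewrite /top; lra.
have CE : C * rho ^+ 2 = top by rewrite divfK // gt_eqF.
rewrite ler_norml; apply/andP; split.
  have ball_x0 y : N (y - x0) <= rho -> `|y - x0| < r.
    by apply: ball_r; rewrite subrr inorm0 ltW.
  have := @quadratic_descent x0 rho C rho0 ball_x0 C0.
  rewrite CE => /(_ _ x xr) h.
  have {}h : F x0 <= F x + L' * N (x - x0) + C * N (x - x0) ^+ 2.
    by apply: h; rewrite /top; lra.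
  lra.
have := @quadratic_descent x rho C rho0 ball_x C0.
rewrite CE => /(_ Fx_top x0 rx); rewrite inorm_distC; lra.
Unshelve. all: by end_near. Qed.

End LocalLipschitz.

End InnerProduct.

(** * Derivatives with explicit bounds *)

Section Frechet.
Variables (R : realType).

(** Here D is a candidate, whereas 'd f x is a chosen value: identities between
    derivatives are then obtained from frechet_unique, without rewriting
    in 'd. *)
Definition frechet (E F : normedModType R) (f : E -> F) (x : E) (D : E -> F) :=
  [/\ linear D, exists C : R, forall h, `|D h| <= C * `|h|
    & forall e : R, 0 < e ->
        \forall y \near x, `|f y - f x - D (y - x)| <= e * `|y - x|].

Lemma frechet_diff (E F : normedModType R) (f : E -> F) x D :
  frechet f x D -> differentiable f x /\ 'd f x = D :> (E -> F).
Proof.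
move=> [linD [C DC] fD].
pose L : {linear E -> F} := HB.pack D (GRing.isLinear.Build R E F _ D linD).
have cL : continuous L.
  move=> u; apply/cvgrPdist_le => e e0.
  have C0 : 0 < `|C| + 1 by rewrite ltr_pwDr.
  near=> v; rewrite -linearB; apply: le_trans (DC _) _.
  apply: (@le_trans _ _ ((`|C| + 1) * `|u - v|)).
    by rewrite ler_wpM2r // (le_trans (ler_norm _)) // lerDl.
  rewrite -ler_pdivlMl //.
  by near: v; apply: cvgr_dist_le => //; rewrite mulr_gt0 // invr_gt0.
have expand : f \o shift x = cst (f x) + L +o_ 0 id.
  apply/eqaddoP => e e0.
  have : \forall h \near (0 : E), `|f (h + x) - f x - D h| <= e * `|h|.
    have := fD _ e0; rewrite (near_shift 0) /=.
    by apply: filterS => h /=; rewrite subr0 addrK.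
  by apply: filterS => h; rewrite /= opprD addrA.
have dE := diff_unique cL expand; split=> //.
by apply/diff_locallyP; rewrite dE; split.
Unshelve. all: by end_near. Qed.

Lemma diff_frechet (E F : normedModType R) (f : E -> F) x :
  differentiable f x -> frechet f x ('d f x).
Proof.
move=> df; have cd : continuous ('d f x) by exact: diff_continuous.
split; first exact: linearP.
  have [C C0 hC] := linear_lipschitz cd; exists C => h; exact: hC.
have /eqaddoP h := diff_locally df.
move=> e e0; rewrite (near_shift 0) /=; have := h _ e0.
by apply: filterS => y /=; rewrite opprD addrA !subr0 addrK.
Qed.

Lemma frechet_comp (E F G : normedModType R) (f : E -> F) (g : F -> G) x Df Dg :
  frechet f x Df -> frechet g (f x) Dg -> frechet (g \o f) x (Dg \o Df).
Proof.
move=> /frechet_diff[df dfE] /frechet_diff[dg dgE].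
have := diff_frechet (differentiable_comp df dg).
by rewrite diff_comp // dfE dgE.
Qed.

Lemma frechet_near (E F : normedModType R) (f g : E -> F) x D :
  (\forall y \near x, f y = g y) -> frechet f x D -> frechet g x D.
Proof.
move=> fg [linD bD fD]; split=> // e e0.
near=> y; have <- : f y = g y by near: y.
rewrite -(nbhs_singleton fg); near: y; exact: fD.
Unshelve. all: by end_near. Qed.

Lemma frechet_unique (E F : normedModType R) (f : E -> F) x D D' :
  frechet f x D -> frechet f x D' -> D = D'.
Proof. by move=> /frechet_diff[_ <-] /frechet_diff[_ <-]. Qed.

Lemma frechet_id (E : normedModType R) (x : E) : frechet id x id.
Proof.
split=> //; first by exists 1 => h; rewrite mul1r.
move=> e e0; apply: nearW => y; by rewrite subrr normr0 mulr_ge0 // ltW.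
Qed.

Lemma frechet_translate (E F : normedModType R) (psi : E -> F) x z D :
  frechet psi (z - x) D -> frechet (fun y => psi (y - x)) z D.
Proof.
move=> fpsi; apply: (@frechet_comp _ _ _ (fun y => y - x) psi z id D _ fpsi).
split=> //; first by exists 1 => h; rewrite mul1r.
move=> e e0; apply: nearW => y.
by rewrite opprB addrA subrK subrr normr0 mulr_ge0 // ltW.
Qed.

Lemma C1_frechet (E F : normedModType R) (U : set E) (f : E -> F) (D : E -> E -> F) :
  open U -> (forall x, U x -> frechet f x (D x)) ->
  (forall x, U x -> forall e : R, 0 < e ->
     \forall y \near x, forall h, `|D y h - D x h| <= e * `|h|) ->
  Ck 1 U f.
Proof.
move=> oU fD cD; split=> x Ux /=; have [df dfE] := frechet_diff (fD _ Ux).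
  split.
  - by move=> [|? ?].
  - have [_ [C DC] _] := fD _ Ux; exists C => -[|h [|? ?]] //= _.
    by rewrite big_seq1 dfE.
  - move=> e e0; have [_ _ /(_ _ e0)] := fD _ Ux.
    by apply: filterS => y ? -[|? ?] //= _; rewrite big_nil mulr1 dfE.
move=> e e0; near=> y => -[|h [|? ?]] //= _.
have Uy : U y by near: y; exact: open_nbhs_nbhs.
have [_ dfyE] := frechet_diff (fD _ Uy).
have cDy : forall k, `|D y k - D x k| <= e * `|k| by near: y; exact: cD.
by rewrite big_seq1 dfE dfyE.
Unshelve. all: by end_near. Qed.

Lemma C1_mderiv (E F : normedModType R) (U : set E) (f : E -> F) x :
  Ck 1 U f -> U x -> frechet f x ('d f x) /\
  forall e : R, 0 < e ->
    \forall y \near x, forall h, `|'d f y h - 'd f x h| <= e * `|h|.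
Proof.
move=> [df cf] Ux; split.
  by have [+ _ _] := df _ Ux; move=> /(_ [::] erefl) /diff_frechet.
move=> e e0; have := cf _ Ux _ e0; apply: filterS => y h v.
by have := h [:: v] erefl; rewrite /= big_seq1.
Qed.

End Frechet.

Section Segments.
Variables (R : realType) (H : normedModType R).

Lemma affine_cvg (sigma : R -> H) (z : H) (t : R) :
  (forall s t, sigma s - sigma t = (s - t) *: z) -> sigma @ t --> sigma t.
Proof.
move=> sigmaB.
have : (fun s => sigma t + (s - t) *: z) @ t --> sigma t + (t - t) *: z.
  apply: cvgD; first exact: cvg_cst.
  apply: cvgZ; last exact: cvg_cst.
  by apply: cvgB; [exact: cvg_id | exact: cvg_cst].
have -> : (fun s => sigma t + (s - t) *: z) = sigma.
  by apply/funext => s; rewrite -sigmaB addrC subrK.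
by rewrite subrr scale0r addr0.
Qed.

(** The mean value inequality along a segment, where tau is only known to be
    differentiable at the points of the segment; the 1 in L + 1 absorbs the
    error of the first-order expansion. *)
Lemma segment_lipschitz (u sigma : R -> H) (tau : H -> H) (k L : R) (z : H) s0 s1 :
  s0 <= s1 -> 0 <= L ->
  (forall s t, sigma s - sigma t = (s - t) *: z) ->
  (forall s, s0 <= s <= s1 -> u s = tau (sigma s)) ->
  (forall s, s0 <= s <= s1 -> exists2 D, frechet tau (sigma s) D &
     forall w, `|D w| <= L * `|w|) ->
  (L + 1) * `|z| <= k ->
  `|u s1 - u s0| <= k * (s1 - s0).
Proof.
move=> s01 L0 sigmaB uE Dtau Lk.
apply: (@interval_chain R (fun s t => `|u t - u s| <= k * (t - s))) => //.
  move=> s t t' _ _ _ _ h1 h2; rewrite -(subrK (u t) (u t')) -addrA.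
  by apply: le_trans (ler_normD _ _) _; lra.
move=> t ht; have [D [_ _ tauD] DL] := Dtau t ht.
have sigma_cvg := affine_cvg (t := t) sigmaB.
have near_t : \forall s \near t, `|tau (sigma s) - tau (sigma t) -
    D (sigma s - sigma t)| <= 1 * `|sigma s - sigma t|.
  exact: sigma_cvg _ (tauD 1 ltr01).
have step s : s0 <= s <= s1 ->
    `|tau (sigma s) - tau (sigma t) - D (sigma s - sigma t)| <=
      1 * `|sigma s - sigma t| -> `|u s - u t| <= k * `|s - t|.
  move=> hs h; rewrite !uE //.
  have : `|tau (sigma s) - tau (sigma t)| <= (L + 1) * `|sigma s - sigma t|.
    rewrite -(subrK (D (sigma s - sigma t)) (_ - tau (sigma t))).
    by apply: le_trans (ler_normD _ _) _; have := DL (sigma s - sigma t); lra.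
  move=> /le_trans; apply; rewrite sigmaB normrZ mulrCA mulrC.
  by rewrite ler_wpM2r.
apply: filterS near_t => s hs; split => /andP[h1 h2].
  rewrite distrC -[t - s]ger0_norm ?subr_ge0 // distrC (distrC t).
  rewrite distrC; apply: step => //; rewrite h1 (le_trans h2) //.
  by case/andP: ht.
rewrite -[s - t]ger0_norm ?subr_ge0 //; apply: step => //.
by rewrite h2 andbT (le_trans _ h1) //; case/andP: ht.
Qed.
End Segments.

(** * A bump function that extends a quadratic minorant *)

(** The derivative 2 max(0, t) of max(0, t)^2 is 2-Lipschitz. *)
Lemma sqr_pos_part_expand (R : realType) (t k : R) :
  `|Num.max 0 (t + k) ^+ 2 - Num.max 0 t ^+ 2 - 2 * Num.max 0 t * k| <= k ^+ 2.
Proof.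
rewrite ler_norml; case: (leP 0 (t + k)) => h1; case: (leP 0 t) => h2;
  by apply/andP; split; nra.
Qed.

Section TestFunction.
Variables (R : realType) (H : completeNormedModType R).
Variables (B : H -> H -> R) (a b : R).
Hypothesis hB : equivalent_form B a b.
Variables (v : H) (s : R).
Local Notation N := (inorm B).

Let profile w : R := 1 + B v w - s * B w w.

(** Near 0 this is (1 + u)^2 / 2 with u = B v w - s * B w w, hence it is tangent
    at 0 to 1/2 + B v w; when s is large, 1 + u is negative off a small ball.
    So one formula serves as minorant and as cut-off. *)
Definition test_fun (w : H) : R := Num.max 0 (profile w) ^+ 2 / 2.

Definition test_grad (w : H) : H := Num.max 0 (profile w) *: (v - (2 * s) *: w).

Let Bsym : forall v w, B v w = B w v. Proof. by case: hB. Qed.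
Let b_gt0 : 0 < b. Proof. by case: hB. Qed.

Lemma frechet_test w : frechet test_fun w (B (test_grad w)).
Proof.
split.
- by move=> k u u'; rewrite (formDr hB) (formZr hB).
- exists (b ^+ 2 * `|test_grad w|) => h; exact: abs_form_le_norm hB _ _.
move=> e e0.
pose p := Num.max 0 (profile w).
pose g := v - (2 * s) *: w.
have p0 : 0 <= p by rewrite le_max lexx.
pose C := (b ^+ 2 * `|g| + `|s| * b ^+ 2) ^+ 2 / 2 + p * `|s| * b ^+ 2.
have C0 : 0 <= C.
  apply: addr_ge0; first by rewrite divr_ge0 ?sqr_ge0.
  exact: mulr_ge0 (mulr_ge0 p0 (normr_ge0 _)) (sqr_ge0 _).
near=> y; have [h hE] : exists h, h = y - w by exists (y - w).
have h1 : `|h| <= 1.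
  by rewrite hE distrC; near: y; apply: cvgr_dist_le => //; exact: cvg_id.
have hC : `|h| <= e / (C + 1).
  rewrite hE distrC; near: y; apply: cvgr_dist_le; first exact: cvg_id.
  by rewrite divr_gt0 // ltr_wpDl.
have yE : y = w + h by rewrite hE addrC subrK.
pose k := B g h - s * B h h.
have profE : profile y = profile w + k.
  by rewrite /profile /k /g yE !(formE hB) (Bsym h w); ring.
have kE : `|k| <= (b ^+ 2 * `|g| + `|s| * b ^+ 2) * `|h|.
  apply: le_trans (ler_normB _ _) _; rewrite mulrDl lerD //.
    exact: abs_form_le_norm hB _ _.
  rewrite normrM -mulrA ler_wpM2l //.
  apply: le_trans (abs_form_le_norm hB _ _) _.
  by rewrite -mulrA ler_wpM2l ?sqr_ge0 // ler_piMl.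
rewrite -hE.
have -> : test_fun y - test_fun w - B (test_grad w) h =
    (Num.max 0 (profile w + k) ^+ 2 - p ^+ 2 - 2 * p * k) / 2 - p * (s * B h h).
  rewrite /test_fun /test_grad profE -/p -/g (formZl hB) /k; by field.
have k2 : k ^+ 2 <= ((b ^+ 2 * `|g| + `|s| * b ^+ 2) * `|h|) ^+ 2.
  by rewrite -(real_normK (num_real k)) lerXn2r // nnegrE // (le_trans _ kE).
have q2 : `|s * B h h| <= `|s| * b ^+ 2 * `|h| ^+ 2.
  rewrite normrM -mulrA; apply: ler_wpM2l => //.
  by have := abs_form_le_norm hB h h; rewrite -mulrA -[`|h| * _]expr2.
apply: (@le_trans _ _ (C * `|h| ^+ 2)).
  apply: le_trans (ler_normB _ _) _; rewrite /C [leRHS]mulrDl; apply: lerD.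
    rewrite normrM [`|2^-1|]gtr0_norm ?invr_gt0 // [leRHS]mulrAC ler_wpM2r //.
    by rewrite -exprMn; apply: le_trans k2; exact: sqr_pos_part_expand.
  rewrite normrM ger0_norm //.
  have -> : p * `|s| * b ^+ 2 * `|h| ^+ 2 = p * (`|s| * b ^+ 2 * `|h| ^+ 2).
    by rewrite !mulrA.
  by apply: ler_wpM2l.
rewrite expr2 mulrA ler_wpM2r //.
apply: (@le_trans _ _ ((C + 1) * `|h|)); first by rewrite ler_wpM2r // lerDl.
by rewrite mulrC -ler_pdivlMr // ltr_wpDl.
Unshelve. all: by end_near. Qed.

Lemma test_grad_continuous : continuous test_grad.
Proof.
move=> w; apply: cvgZ.
  apply: (@continuous_max _ _ (cst 0) profile); first exact: cvg_cst.
  apply: cvgB; first by apply: cvgD; [exact: cvg_cst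
    | apply: (form_cvg hB); [exact: cvg_cst | exact: cvg_id]].
  by apply: cvgMr; apply: (form_cvg hB); exact: cvg_id.
by apply: cvgB; [exact: cvg_cst | apply: cvgZr; exact: cvg_id].
Qed.

Lemma test_fun0 : test_fun 0 = 2^-1.
Proof.
rewrite /test_fun /profile (formE hB, form0l hB) (Bsym v) !(form0l hB).
by rewrite mulr0 subr0 addr0 max_r // expr1n mul1r.
Qed.

Lemma test_grad0 : test_grad 0 = v.
Proof.
rewrite /test_grad /profile (Bsym v) !(form0l hB) mulr0 subr0 addr0 max_r //.
by rewrite scale1r scaler0 subr0.
Qed.

Lemma test_support rho w :
  0 < rho -> rho ^- 2 + N v / rho <= s -> rho <= N w ->
  test_fun w = 0 /\ test_grad w = 0.
Proof.
move=> rho0 hs hw.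
suff neg : profile w <= 0.
  by rewrite /test_fun /test_grad max_l // expr0n mul0r scale0r.
rewrite /profile.
have := form_le_inorm hB v w; rewrite -(sqr_inorm hB w) => vw.
have Nv := inorm_ge0 B v.
have r2 : 0 < rho ^- 2 by rewrite invr_gt0 exprn_gt0.
have Nw2 : rho ^+ 2 <= N w ^+ 2 by rewrite lerXn2r // nnegrE ?inorm_ge0 // ltW.
have h1 : 1 <= rho ^- 2 * N w ^+ 2.
  by rewrite mulrC ler_pdivlMr ?exprn_gt0 // mul1r.
have h2 : N v * N w <= N v / rho * N w ^+ 2.
  rewrite -mulrA ler_wpM2l // mulrC ler_pdivlMr // expr2.
  by rewrite ler_wpM2l ?inorm_ge0.
have : (rho ^- 2 + N v / rho) * N w ^+ 2 <= s * N w ^+ 2.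
  by rewrite ler_wpM2r ?sqr_ge0.
rewrite mulrDl; lra.
Qed.

(** (1 + u)^2 / 2 exceeds 1/2 + u by u^2 / 2, which is of second order in w and
    is absorbed by the difference between s and s0. *)
Lemma test_fun_le s0 : s0 + (N v + 1) ^+ 2 / 2 <= s ->
  \forall w \near 0, test_fun w <= 2^-1 + (B v w - s0 * B w w).
Proof.
move=> hs.
have c0 : (fun w => `|s| * N w) @ (0 : H) --> `|s| * N 0.
  by apply: cvgMr; apply: (inorm_cvg hB); exact: cvg_id.
rewrite (inorm0 hB) mulr0 in c0.
near=> w.
have sN : `|s| * N w <= 1 by near: w; apply: cvgr_le c0 _ _.
pose u := B v w - s * B w w.
have uN : `|u| <= (N v + 1) * N w.
  apply: le_trans (ler_normB _ _) _; rewrite mulrDl lerD ?(abs_form_le hB) //.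
  rewrite normrM -(sqr_inorm hB) mul1r.
  by rewrite [`|_ ^+ 2|]ger0_norm ?sqr_ge0 // expr2 mulrA ler_piMl ?inorm_ge0.
have u2 : u ^+ 2 <= (N v + 1) ^+ 2 * B w w.
  rewrite -(sqr_inorm hB) -exprMn -(real_normK (num_real u)).
  by rewrite lerXn2r // nnegrE // (le_trans _ uN).
have P : Num.max 0 (profile w) ^+ 2 <= (1 + u) ^+ 2.
  have -> : profile w = 1 + u by rewrite /profile /u addrA.
  by case: (leP 0 (1 + u)) => _ ; rewrite ?lexx // expr0n /= sqr_ge0.
have := ler_wpM2r (form_ge0 hB w) hs.
rewrite /test_fun; move: P; rewrite sqrrD /u in u2 *; lra.
Unshelve. all: by end_near. Qed.

End TestFunction.

(** * Charts, tangent vectors and the metric *)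

Section Charts.
Variables (R : realType) (H : completeNormedModType R) (M : topologicalType).
Variables (X : smooth_structure H M) (g : riemannian_metric X).
Implicit Types (c : chart H M) (p : M) (y v w : H).

Definition metric_at p : H -> H -> R := @rmetric R H M X g p.

Definition to_tangent c y : H -> H := tangent_of_chart X c y.

Definition chart_metric c y v w : R :=
  metric_at (chart_inv c y) (to_tangent c y v) (to_tangent c y w).

Definition transition c c' : H -> H := chart_map c' \o chart_inv c.

Definition dtransition c c' y : H -> H := 'd (transition c c') y.

Lemma metric_equivalent p : exists a b, equivalent_form (metric_at p) a b.
Proof.
have [a [b [a0 hab]]] := rmetric_equiv g p.
exists a, (`|b| + 1); split => //.
- exact: rmetric_sym.
- exact: rmetric_linear.
- move=> v; have /andP[-> h] := hab v; rewrite /= (le_trans h) // ler_wpM2r //.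
  by rewrite (le_trans (ler_norm _)) // lerDl.
Qed.

Lemma chart_inv_near c y (A : set M) : chart_cod c y ->
  nbhs (chart_inv c y) A -> \forall x \near y, A (chart_inv c x).
Proof. by move=> cy; apply: chart_inv_continuous; exact: mem_set. Qed.

Lemma chart_map_near c p (A : set H) : chart_dom c p ->
  nbhs (chart_map c p) A -> \forall q \near p, A (chart_map c q).
Proof. by move=> cp; apply: chart_map_continuous; exact: mem_set. Qed.

Lemma chart_dom_near c p : chart_dom c p -> \forall q \near p, chart_dom c q.
Proof. by move=> cp; apply: open_nbhs_nbhs; split=> //; exact: chart_dom_open. Qed.

Lemma chart_cod_near c y : chart_cod c y -> \forall x \near y, chart_cod c x.
Proof. by move=> cy; apply: open_nbhs_nbhs; split=> //; exact: chart_cod_open. Qed.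

Lemma frechet_transition c c' y : atlas X c -> atlas X c' ->
  chart_cod c y -> chart_dom c' (chart_inv c y) ->
  frechet (transition c c') y (dtransition c c' y) /\
  forall e : R, 0 < e -> \forall x \near y, forall h,
    `|dtransition c c' x h - dtransition c c' y h| <= e * `|h|.
Proof.
move=> Xc Xc' cy c'y.
by apply: (C1_mderiv (transition_smooth Xc Xc' 1)).
Qed.

Lemma to_tangent_frechet c y : atlas X c -> chart_cod c y ->
  frechet (chart_map (chart_at X (chart_inv c y)) \o chart_inv c) y
    (to_tangent c y).
Proof.
move=> Xc cy; apply: (frechet_transition Xc (chart_at_atlas X _) cy _).1.
exact: chart_at_dom.
Qed.

(** Both sides are derivatives of the same map near y, since going through c'
    does not change the point of M. *)
Lemma to_tangent_transition c c' y : atlas X c -> atlas X c' ->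
  chart_cod c y -> chart_dom c' (chart_inv c y) ->
  to_tangent c y = to_tangent c' (transition c c' y) \o dtransition c c' y.
Proof.
move=> Xc Xc' cy c'y; apply: frechet_unique (to_tangent_frechet Xc cy) _.
have inv_trans : chart_inv c' (transition c c' y) = chart_inv c y.
  by rewrite /transition /= chart_mapK.
have c'ty : chart_cod c' (transition c c' y) by exact: chart_map_cod.
have := frechet_comp (frechet_transition Xc Xc' cy c'y).1
  (to_tangent_frechet Xc' c'ty).
rewrite inv_trans; apply: frechet_near.
apply: filterS (chart_inv_near cy (chart_dom_near c'y)) => x c'x.
by rewrite /transition /= chart_mapK.
Qed.

Lemma to_tangent_chart_at p :
  to_tangent (chart_at X p) (chart_map (chart_at X p) p) = id.
Proof.
set c := chart_at X p.
have cp : chart_dom c p by exact: chart_at_dom.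
have cy : chart_cod c (chart_map c p) by exact: chart_map_cod.
apply: frechet_unique (to_tangent_frechet (chart_at_atlas X p) cy) _.
apply: frechet_near (frechet_id _); rewrite chart_mapK // -/c.
by apply: filterS (chart_cod_near cy) => x cx; rewrite /= chart_invK.
Qed.

Lemma chart_metric_transition c c' y v w : atlas X c -> atlas X c' ->
  chart_cod c y -> chart_dom c' (chart_inv c y) ->
  chart_metric c y v w =
  chart_metric c' (transition c c' y) (dtransition c c' y v) (dtransition c c' y w).
Proof.
move=> Xc Xc' cy c'y; rewrite /chart_metric (to_tangent_transition Xc Xc') //=.
by rewrite /transition /= chart_mapK.
Qed.

Lemma chart_metric_at p v w :
  chart_metric (chart_at X p) (chart_map (chart_at X p) p) v w = metric_at p v w.
Proof.
rewrite /chart_metric to_tangent_chart_at chart_mapK //; exact: chart_at_dom.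
Qed.

Lemma chart_metric_near c y (e : R) : atlas X c -> chart_cod c y -> 0 < e ->
  \forall x \near y, forall v w,
    `|chart_metric c x v w - chart_metric c y v w| <= e * `|v| * `|w|.
Proof.
move=> Xc cy e0; have := rmetric_smooth g Xc 0 _ cy _ e0.
apply: filterS => x h v w; have := h [:: v; w] erefl.
by rewrite !big_cons big_nil mulr1 mulrA.
Qed.

Lemma chart_metric_lower p : exists2 alpha : R, 0 < alpha &
  \forall x \near chart_map (chart_at X p) p, forall w,
    alpha * `|w| ^+ 2 <= chart_metric (chart_at X p) x w w.
Proof.
have [a [b hB]] := metric_equivalent p.
have a0 : 0 < a by case: hB.
have a2 : 0 < a ^+ 2 / 2 by rewrite divr_gt0 // exprn_gt0.
exists (a ^+ 2 / 2) => //.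
have cod0 : chart_cod (chart_at X p) (chart_map (chart_at X p) p).
  by apply: chart_map_cod; exact: chart_at_dom.
have := chart_metric_near (chart_at_atlas X p) cod0 a2.
apply: filterS => x /[swap] w /(_ w w).
rewrite chart_metric_at ler_norml -mulrA -expr2 => /andP[+ _].
have : (a * `|w|) ^+ 2 <= metric_at p w w.
  rewrite -(sqr_inorm hB) lerXn2r ?nnegrE ?inorm_ge0 //.
    by rewrite mulr_ge0 // ltW.
  exact: inorm_lower hB _.
rewrite exprMn; lra.
Qed.

Lemma chart_metric_upper p : exists2 beta : R, 0 < beta &
  \forall x \near chart_map (chart_at X p) p, forall w,
    chart_metric (chart_at X p) x w w <= beta * `|w| ^+ 2.
Proof.
have [a [b hB]] := metric_equivalent p.
have b0 : 0 < b by case: hB.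
exists (b ^+ 2 + 1); first by rewrite ltr_pwDr // sqr_ge0.
have cod0 : chart_cod (chart_at X p) (chart_map (chart_at X p) p).
  by apply: chart_map_cod; exact: chart_at_dom.
have := chart_metric_near (chart_at_atlas X p) cod0 (ltr01 : 0 < (1 : R)).
apply: filterS => x /[swap] w /(_ w w).
rewrite chart_metric_at ler_norml mul1r -expr2 => /andP[_ +].
have := abs_form_le_norm hB w w; rewrite -mulrA -expr2 ler_norml => /andP[_].
lra.
Qed.

Lemma chart_norm_near p (t : R) : 1 < t ->
  \forall x \near chart_map (chart_at X p) p, forall w,
    Num.sqrt (chart_metric (chart_at X p) x w w) <= t * inorm (metric_at p) w.
Proof.
move=> t1; have [a [b hB]] := metric_equivalent p.
have a0 : 0 < a by case: hB.
have a2 : 0 < a ^+ 2 by rewrite exprn_gt0.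
have t2 : 0 < t ^+ 2 - 1 by rewrite subr_gt0 expr_gt1 // (le_trans ler01) ?ltW.
have e0 : 0 < a ^+ 2 * (t ^+ 2 - 1) by rewrite mulr_gt0.
have cod0 : chart_cod (chart_at X p) (chart_map (chart_at X p) p).
  by apply: chart_map_cod; exact: chart_at_dom.
have := chart_metric_near (chart_at_atlas X p) cod0 e0.
apply: filterS => x /[swap] w /(_ w w).
rewrite chart_metric_at ler_norml => /andP[_ h].
have t0 : 0 <= t by rewrite (le_trans ler01) // ltW.
have Nw := inorm_ge0 (metric_at p) w.
rewrite -[leRHS]ger0_norm ?mulr_ge0 // -sqrtr_sqr ler_wsqrtr // exprMn.
have : (t ^+ 2 - 1) * (a * `|w|) ^+ 2 <= (t ^+ 2 - 1) * inorm (metric_at p) w ^+ 2.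
  rewrite ler_pM2l // lerXn2r ?nnegrE //; last exact: inorm_lower hB _.
  by rewrite mulr_ge0 // ltW.
move: h; rewrite (sqr_inorm hB) exprMn; lra.
Qed.

End Charts.

(** * Small closed sets of a chart are closed in the manifold *)

Section ClosedImages.
Variables (R : realType) (H : completeNormedModType R) (M : topologicalType).
Variables (X : smooth_structure H M) (g : riemannian_metric X).
Implicit Types (c : chart H M) (p : M) (x y v w : H).

Hypothesis M_hausdorff : hausdorff_space M.

(** The only difficulty is a limit point z outside the domain of c.  In the
    chart c' around z, join to z a point of the set close to z.  While the
    segment stays in the ball of radius r0 of c, the metric compares the two
    charts, so the trace u of the segment in c is Lipschitz with a small
    constant k: it stays away from the sphere of radius r0, and at any time t
    it has a limit in the chart, which is the point of the segment at time t
    because M is Hausdorff.  Hence the whole segment lies in the domain of c,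
    and so does z. *)
Lemma closed_chart_image p : exists2 r : R, 0 < r &
  forall A : set H, closed A ->
    (forall y, A y -> `|y - chart_map (chart_at X p) p| <= r) ->
    closed (chart_inv (chart_at X p) @` A).
Proof.
set c := chart_at X p; set x0 := chart_map c p.
have Xc : atlas X c by exact: chart_at_atlas.
have cod0 : chart_cod c x0 by apply: chart_map_cod; exact: chart_at_dom.
have [alpha alpha0 lower] := chart_metric_lower g p.
have /nbhs_ballP[r0 /= r00 ball_r0] :
    \forall x \near x0, chart_cod c x /\
      forall w, alpha * `|w| ^+ 2 <= chart_metric g c x w w.
  by apply: filterS2 (chart_cod_near cod0) lower.
have in_ball x : `|x - x0| < r0 -> chart_cod c x /\
    forall w, alpha * `|w| ^+ 2 <= chart_metric g c x w w.
  by move=> xr; apply: ball_r0; rewrite -ball_normE /= distrC.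
exists (r0 / 2) => [|A cA Ar]; first by rewrite divr_gt0.
move=> z clz.
have [cz|ncz] := pselect (chart_dom c z).
  exists (chart_map c z); last exact: chart_mapK.
  apply: cA => V Vcz.
  have := clz _ (filterI (chart_dom_near cz) (chart_map_near cz Vcz)).
  move=> [_ [[y Ay <-] [_ Vy]]]; exists y; split=> //.
  rewrite chart_invK // in Vy; apply: (in_ball y _).1.
  by apply: le_lt_trans (Ar _ Ay) _; rewrite ltr_pdivrMr // ltr_pMr // ltr1n.
exfalso; apply: ncz.
pose c' := chart_at X z; pose z' := chart_map c' z.
have Xc' : atlas X c' by exact: chart_at_atlas.
have dom_z : chart_dom c' z by exact: chart_at_dom.
have codz : chart_cod c' z' by exact: chart_map_cod.
have [beta beta0 upper] := chart_metric_upper g z.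
pose L := Num.sqrt (beta / alpha).
have L0 : 0 <= L by exact: sqrtr_ge0.
have L1 : 0 < L + 1 by rewrite ltr_wpDl.
have /nbhs_ballP[d0 /= d00 ball_d0] :
    \forall x \near z', chart_cod c' x /\
      forall w, chart_metric g c' x w w <= beta * `|w| ^+ 2.
  by apply: filterS2 (chart_cod_near codz) upper.
pose k := r0 / 2 / 2.
pose d := Num.min d0 (k / (L + 1)).
have k0 : 0 < k by rewrite !divr_gt0.
have dpos : 0 < d by rewrite lt_min d00 divr_gt0.
have [m0 [[y Ay ym0] [dom_m0 m0z]]] :=
  clz _ (filterI (chart_dom_near dom_z) (chart_map_near dom_z (nbhsx_ballx z' _ dpos))).
pose y' := chart_map c' m0.
pose sigma (s : R) := y' + s *: (z' - y').
pose pt s := chart_inv c' (sigma s).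
pose u s := chart_map c (pt s).
have y'z : `|z' - y'| < d by move: m0z; rewrite -ball_normE.
have sigmaB s t : sigma s - sigma t = (s - t) *: (z' - y').
  by rewrite /sigma opprD addrACA subrr add0r scalerBl.
have sigma0 : sigma 0 = y' by rewrite /sigma scale0r addr0.
have sigma1 : sigma 1 = z' by rewrite /sigma scale1r addrC subrK.
have sigma_ball s : 0 <= s <= 1 -> chart_cod c' (sigma s) /\
    forall w, chart_metric g c' (sigma s) w w <= beta * `|w| ^+ 2.
  move=> /andP[s0 s1]; apply: ball_d0; rewrite -ball_normE /= -sigma1 sigmaB normrZ.
  rewrite ger0_norm ?subr_ge0 //.
  apply: le_lt_trans (_ : _ <= `|z' - y'|) _; first by rewrite ler_piMl // lerBlDr lerDl.
  by apply: lt_le_trans y'z _; rewrite ge_min lexx.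
have kL : (L + 1) * `|z' - y'| <= k.
  rewrite -ler_pdivlMl // mulrC; apply: ltW; apply: lt_le_trans y'z _.
  by rewrite ge_min lexx orbT.
pose good s := chart_dom c (pt s) /\ `|u s - x0| < r0.
have lip s t : 0 <= s -> s <= t -> t <= 1 ->
    (forall s', s <= s' <= t -> good s') -> `|u t - u s| <= k * (t - s).
  move=> s0 st t1 hgood.
  apply: (@segment_lipschitz _ _ u sigma (transition c' c) k L (z' - y')) => //.
  move=> s' hs'; have [dom_s' us'] := hgood _ hs'.
  have [|cod_s' up] := sigma_ball s'.
    by case/andP: hs' => h1 h2; rewrite (le_trans s0 h1) (le_trans h2 t1).
  exists (dtransition c' c (sigma s')).
    exact: (frechet_transition Xc' Xc cod_s' dom_s').1.
  move=> w; have [_ /(_ (dtransition c' c (sigma s') w)) lo] := in_ball _ us'.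
  have := le_trans lo; rewrite -[u s']/(transition c' c (sigma s')).
  rewrite -chart_metric_transition // => /(_ _ (up w)).
  rewrite -ler_pdivlMl // mulrA mulrC [alpha^-1 * _]mulrC => h.
  rewrite -(@ler_pXn2r _ 2%N) ?nnegrE ?mulr_ge0 // exprMn sqr_sqrtr; last first.
    by rewrite divr_ge0 // ltW.
  by rewrite mulrC.
have pt_near t (V : set M) : 0 <= t <= 1 -> nbhs (pt t) V ->
    \forall s \near t, V (pt s).
  move=> /sigma_ball[cod_t _] Vt.
  exact: (affine_cvg (t := t) sigmaB) _ (chart_inv_near cod_t Vt).
have good_near t : 0 <= t <= 1 -> good t -> \forall s \near t, good s.
  move=> t01 [dom_t ut].
  have near_u : \forall s \near t, `|u s - x0| < r0.
    apply: (pt_near t (fun m => `|chart_map c m - x0| < r0) t01).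
    apply: (@chart_map_near _ _ _ c (pt t) (fun x => `|x - x0| < r0) dom_t).
    have : open_nbhs (u t) (ball x0 r0).
      split; first exact: ball_open.
      by rewrite -ball_normE /= distrC.
    by move=> /open_nbhs_nbhs; apply: filterS => x; rewrite -ball_normE /= distrC.
  by apply: filterS2 (pt_near _ _ t01 (chart_dom_near dom_t)) near_u.
have y_r0 : `|y - x0| < r0.
  apply: le_lt_trans (Ar _ Ay) _.
  by rewrite ltr_pdivrMr // ltr_pMr // ltr1n.
have cod_y : chart_cod c y := (in_ball _ y_r0).1.
have u0 : u 0 = y by rewrite /u /pt sigma0 /y' chart_mapK // -ym0 chart_invK.
have good0 : good 0.
  split; last by rewrite u0.
  by rewrite /pt sigma0 /y' chart_mapK // -ym0; exact: chart_inv_dom.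
have good_closed t : 0 < t <= 1 -> (forall s, 0 <= s < t -> good s) -> good t.
  move=> /andP[t0 t1] hgood.
  pose s_ n : R := t - t * 2^-1 ^+ n.
  have half0 n : 0 < (2^-1 : R) ^+ n by rewrite exprn_gt0.
  have half1 n : (2^-1 : R) ^+ n <= 1 by rewrite exprn_ile1 // invf_le1 // ler1n.
  have s_0 n : 0 <= s_ n by rewrite subr_ge0 ler_piMr // ltW.
  have s_t n : s_ n < t by rewrite /s_ ltrBlDr ltrDl mulr_gt0.
  have s_1 n : s_ n <= 1 by rewrite (le_trans (ltW (s_t n))).
  have half_cvg : (fun n => (2^-1 : R) ^+ n) @ \oo --> (0 : R).
    by apply: cvg_expr; rewrite ger0_norm // invf_lt1 // ltr1n.
  have s_cvg : s_ @ \oo --> t.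
    rewrite -[X in _ --> X]subr0 -[X in _ - X](mulr0 t).
    by apply: cvgB; [exact: cvg_cst | exact: cvgMr].
  have u_cvg : cvgn (fun n => u (s_ n)).
    apply: (@geometric_cvgn _ _ _ k) => n.
    have sS : s_ n.+1 - s_ n = t / 2 * 2^-1 ^+ n by rewrite /s_ exprS; field.
    have sS0 : 0 <= s_ n.+1 - s_ n by rewrite sS !mulr_ge0 // ltW.
    have := lip (s_ n) (s_ n.+1) (s_0 n); rewrite -subr_ge0 => /(_ sS0 (s_1 _)) h.
    apply: le_trans (h _) _.
      move=> s' /andP[h1 h2]; apply: hgood.
      by rewrite (le_trans (s_0 n) h1) (le_lt_trans h2 (s_t _)).
    rewrite sS ler_wpM2l ?(ltW k0) // ler_piMl ?(ltW (half0 _)) //.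
    by lra.
  set ul := limn (fun n => u (s_ n)) in u_cvg.
  have ul_near : `|ul - u 0| <= k.
    have cn : (fun n => `|u (s_ n) - u 0|) @ \oo --> `|ul - u 0|.
      by apply: cvg_norm; apply: cvgB; [exact: u_cvg | exact: cvg_cst].
    apply: (cvgr_to_le cn); apply: nearW => n.
    have := lip 0 (s_ n) (lexx _) (s_0 n) (s_1 n); rewrite subr0.
    move=> h; apply: le_trans (h _) _.
      by move=> s' /andP[h1 h2]; apply: hgood; rewrite h1 (le_lt_trans h2 (s_t _)).
    by rewrite ler_piMr // ltW.
  have ul_r0 : `|ul - x0| < r0.
    rewrite -(subrK (u 0) ul) -addrA; apply: le_lt_trans (ler_normD _ _) _.
    by have := Ar _ Ay; rewrite -u0; move: ul_near; rewrite /k; lra.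
  have ul_cod := (in_ball _ ul_r0).1.
  have lim1 : (fun n => pt (s_ n)) @ \oo --> pt t.
    move=> V Vt; have hV : \forall s \near t, V (pt s).
      by apply: pt_near Vt; rewrite (ltW t0) t1.
    exact: (s_cvg _ hV).
  have lim2 : (fun n => pt (s_ n)) @ \oo --> chart_inv c ul.
    move=> V /(chart_inv_near ul_cod) hV.
    have hVn : \forall n \near \oo, V (chart_inv c (u (s_ n))).
      exact: (u_cvg _ hV).
    suff : \forall n \near \oo, V (pt (s_ n)) by [].
    apply: filterS hVn => n; rewrite /u chart_mapK //; apply: (hgood _ _).1.
    by rewrite s_0 s_t.
  have ptE : pt t = chart_inv c ul := cvg_unique M_hausdorff lim1 lim2.
  rewrite /good /u ptE chart_invK //; split=> //; exact: chart_inv_dom.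
(* If goodness fails somewhere before t, then the hypothesis on [0, s] is false
   for s close to t; otherwise good_closed gives goodness at t, and good_near
   extends it beyond t. *)
have chain : (forall s', 0 <= s' <= 0 -> good s') -> (forall s', 0 <= s' <= 1 -> good s').
  apply: (@interval_chain R (fun s t => (forall s', 0 <= s' <= s -> good s') ->
    forall s', 0 <= s' <= t -> good s')) => //.
    by move=> s1 s2 s3 _ _ _ _ h1 h2 /h1/h2.
  move=> t t01; have [t0 t1] := andP t01.
  have [all_lt|] := pselect (forall s, 0 <= s < t -> good s); last first.
    move=> /existsNP[s /not_implyP[/andP[s0 st] ngs]].
    have : \forall s' \near t, s < s' by exact: lt_nbhsr.
    apply: filterS => s' ss'; split => [_|/andP[ts' _]] hgood.
      by exfalso; apply: ngs; apply: hgood; rewrite s0 ltW.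
    by exfalso; apply: ngs; apply: hgood; rewrite s0 ltW.
  have gt : good t.
    move: t0; rewrite le_eqVlt => /orP[/eqP <- //|t0].
    by apply: good_closed => //; rewrite t0.
  have all_le s : 0 <= s <= t -> good s.
    move=> /andP[s0]; rewrite le_eqVlt => /orP[/eqP -> //|st].
    by apply: all_lt; rewrite s0.
  have /nbhs_ballP[e /= e0 he] := good_near t t01 gt.
  apply/nbhs_ballP; exists e => //= s; rewrite -ball_normE /= => se.
  split=> [_ _ //|/andP[ts _] _ s' /andP[s'0 s's]].
  have [s't|ts'] := leP s' t; first by apply: all_le; rewrite s'0.
  apply: he; rewrite -ball_normE /=; apply: le_lt_trans se.
  by rewrite !(distrC t) !ger0_norm ?subr_ge0 ?lerD2r // ltW.
have /chain/(_ 1) : forall s', 0 <= s' <= 0 -> good s'.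
  by move=> s' /le_anti <-.
by rewrite lexx ler01 => /(_ isT)[+ _]; rewrite /pt sigma1 chart_mapK.
Qed.

End ClosedImages.

(** * Quadratic minorants are bounded by the subdifferential *)

Section Subgradients.
Variables (R : realType) (H : completeNormedModType R) (M : topologicalType).
Variables (X : smooth_structure H M) (g : riemannian_metric X).
Hypothesis M_hausdorff : hausdorff_space M.
Implicit Types (c : chart H M) (p : M) (x y v w : H).

Lemma conorm_le p (zeta : H -> R) (K : R) :
  linear (zeta : H -> R^o) -> 0 <= K ->
  (conorm g (zeta : tangent X p -> R) <= K%:E)%E ->
  forall h, `|zeta h| <= K * inorm (metric_at g p) h.
Proof.
move=> linz K0 hK h.
have [a [b hB]] := metric_equivalent g p.
have zetaZ k u : zeta (k *: u) = k * zeta u.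
  have z0 : zeta 0 = 0.
    by have := linz (-1) 0 0; rewrite scaler0 addr0 scaleN1r addNr.
  by have := linz k u 0; rewrite !addr0 z0 addr0.
have [->|h0] := eqVneq h 0.
  by rewrite -[X in zeta X](scale0r h) zetaZ mul0r normr0 mulr_ge0 // inorm_ge0.
have Nh := inorm_gt0 hB h0.
rewrite -ler_pdivrMr // -[X in _ / X](gtr0_norm Nh) -normfV -normrM mulrC -zetaZ.
rewrite -lee_fin; apply: le_trans hK; apply: ereal_sup_ubound.
exists ((inorm (metric_at g p) h)^-1 *: h) => //.
rewrite /= -[LHS]/(inorm (metric_at g p) _) (inormZ hB) gtr0_norm ?invr_gt0 //.
by rewrite mulVf // gt_eqF.
Qed.

Section GlobalTest.
Variables (p : M) (a b : R).
Local Notation B := (metric_at g p).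
Local Notation N := (inorm B).
Local Notation c := (chart_at X p).
Hypothesis hB : equivalent_form B a b.
Variables (x v : H) (s rho : R).
Hypothesis rho_gt0 : 0 < rho.
Hypothesis s_ge : rho ^- 2 + N v / rho <= s.
Hypothesis support_cod : forall y, N (y - x) <= rho -> chart_cod c y.
Hypothesis support_closed : closed (chart_inv c @` [set y | N (y - x) <= rho]).

(** The decision pselect yields 0 off the domain of c, where chart_map c has
    arbitrary values. *)
Definition global_test (m : M) : R :=
  if pselect (chart_dom c m) then test_fun B v s (chart_map c m - x) else 0.

Let dtest (c' : chart H M) (y h : H) : R :=
  if pselect (chart_dom c (chart_inv c' y)) then
    B (test_grad B v s (transition c' c y - x)) (dtransition c' c y h) else 0.

Lemma global_test_dom m : chart_dom c m ->
  global_test m = test_fun B v s (chart_map c m - x).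
Proof. by move=> cm; rewrite /global_test; case: pselect. Qed.

(** A point outside the domain of c is outside the image of the support, which
    is closed, so the function vanishes around it; at the other points it is
    the composition of test_fun with a transition map. *)
Lemma global_test_C1 : C1_function X global_test.
Proof.
move=> c' Xc'; have Xc : atlas X c by exact: chart_at_atlas.
have off_support y : chart_cod c' y -> ~ chart_dom c (chart_inv c' y) ->
    \forall y' \near y, global_test (chart_inv c' y') = 0 /\
      forall h, dtest c' y' h = 0.
  move=> cod_y ndom; pose S := chart_inv c @` [set y | N (y - x) <= rho].
  have oS : open (~` S) by rewrite openC.
  have Sy : (~` S) (chart_inv c' y).
    move=> [z Nz zE]; apply: ndom; rewrite -zE.
    by apply: chart_inv_dom; exact: support_cod.
  have := chart_inv_near cod_y (open_nbhs_nbhs (conj oS Sy)).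
  apply: filterS => y' Sy'.
  rewrite /global_test /dtest; case: pselect => //= dom_y'.
  have Ny' : rho <= N (chart_map c (chart_inv c' y') - x).
    rewrite leNgt; apply/negP => /ltW Ny'; apply: Sy'.
    by exists (chart_map c (chart_inv c' y')) => //; rewrite chart_mapK.
  have [-> g0] := test_support hB rho_gt0 s_ge Ny'; split=> // h.
  by rewrite /transition /= g0 (form0l hB).
apply: (@C1_frechet _ _ _ _ _ (dtest c')); first exact: chart_cod_open.
  move=> y cod_y; have [dom_y|ndom_y] := pselect (chart_dom c (chart_inv c' y)).
    have fr := frechet_comp (frechet_transition Xc' Xc cod_y dom_y).1
      (frechet_translate (frechet_test hB v s (transition c' c y - x))).
    have -> : dtest c' y =
        B (test_grad B v s (transition c' c y - x)) \o dtransition c' c y.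
      by apply/funext => h; rewrite /dtest; case: pselect.
    apply: frechet_near fr.
    apply: filterS (chart_inv_near cod_y (chart_dom_near dom_y)) => y' dom_y'.
    by rewrite /= global_test_dom.
  have -> : dtest c' y = fun=> 0.
    by apply/funext => h; rewrite /dtest; case: pselect.
  apply: (@frechet_near _ _ _ (fun=> 0)).
    by apply: filterS (off_support _ cod_y ndom_y) => y' [h0 _] /=; rewrite h0.
  split.
  - by move=> k h h'; rewrite scaler0 addr0.
  - by exists 0 => h; rewrite normr0 mul0r.
  - move=> e e0; apply: nearW => y'.
    by rewrite !subr0 normr0 mulr_ge0 // ltW.
move=> y cod_y e e0.
have [dom_y|ndom_y] := pselect (chart_dom c (chart_inv c' y)); last first.
  apply: filterS (off_support _ cod_y ndom_y) => y' [_ h0] h.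
  rewrite h0 /dtest; case: pselect => [/ndom_y //|ndom].
  by rewrite subr0 normr0 mulr_ge0 // ltW.
have [[_ [C DC] _] Dcont] := frechet_transition Xc' Xc cod_y dom_y.
set G := test_grad B v s (transition c' c y - x).
pose C1 := `|C| + 1; have C1_0 : 0 < C1 by rewrite ltr_pwDr.
have b0 : 0 < b by case: hB.
have b2 : 0 < b ^+ 2 by rewrite exprn_gt0.
have C1b : 0 < b ^+ 2 * C1 by rewrite mulr_gt0.
have Gb : 0 < b ^+ 2 * `|G| + 1 by rewrite ltr_wpDl // mulr_ge0 // ltW.
have G_cvg : (fun y' => test_grad B v s (transition c' c y' - x)) @ y --> G.
  have tau_cvg : transition c' c @ y --> transition c' c y.
    have [dtau _] := frechet_diff (frechet_transition Xc' Xc cod_y dom_y).1.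
    exact: differentiable_continuous dtau.
  have arg_cvg : (fun y' => transition c' c y' - x) @ y --> transition c' c y - x.
    by apply: cvgB; [exact: tau_cvg | exact: cvg_cst].
  by apply: cvg_comp arg_cvg _; exact: (test_grad_continuous hB).
near=> y'.
have dom_y' : chart_dom c (chart_inv c' y').
  by near: y'; exact: chart_inv_near cod_y (chart_dom_near dom_y).
have dG : `|test_grad B v s (transition c' c y' - x) - G| <= e / 2 / (b ^+ 2 * C1).
  by near: y'; apply: cvgr_distC_le G_cvg _ _; rewrite !divr_gt0.
have dD1 : forall h, `|dtransition c' c y' h - dtransition c' c y h| <= 1 * `|h|.
  by near: y'; exact: Dcont.
have dD2 : forall h, `|dtransition c' c y' h - dtransition c' c y h| <=
    e / 2 / (b ^+ 2 * `|G| + 1) * `|h|.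
  by near: y'; apply: Dcont; rewrite !divr_gt0.
move=> h; have {}dD1 := dD1 h; have {}dD2 := dD2 h.
rewrite /dtest; case: pselect => // ?; case: pselect => // ?; rewrite -/G.
set G' := test_grad _ _ _ _ in dG *.
set D' := dtransition c' c y' h in dD1 dD2 *.
set D := dtransition c' c y h in dD1 dD2 *.
have -> : B G' D' - B G D = B (G' - G) D' + B G (D' - D).
  by rewrite !(formE hB); ring.
have nD' : `|D'| <= C1 * `|h|.
  rewrite -(subrK D D'); apply: le_trans (ler_normD _ _) _.
  have := DC h; have : C * `|h| <= `|C| * `|h| by rewrite ler_wpM2r // ler_norm.
  by rewrite /C1 -/D; lra.
apply: le_trans (ler_normD _ _) _; rewrite (splitr e) mulrDl; apply: lerD.
  apply: le_trans (abs_form_le_norm hB _ _) _.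
  rewrite ler_pdivlMr // in dG.
  rewrite -mulrA; apply: le_trans (ler_wpM2l (ltW b2) (ler_wpM2l (normr_ge0 _) nD')) _.
  have := ler_wpM2r (normr_ge0 h) dG; lra.
apply: le_trans (abs_form_le_norm hB _ _) _.
have h1 : b ^+ 2 * `|G| * `|D' - D| <= (b ^+ 2 * `|G| + 1) * `|D' - D|.
  by rewrite ler_wpM2r // lerDl.
apply: le_trans h1 _; rewrite -ler_pdivlMl //.
by rewrite mulrA [_^-1 * _]mulrC.
Unshelve. all: by end_near. Qed.

(** The differential is taken in the preferred chart of the point, not in c;
    the chain rule through to_tangent relates them. *)
Lemma global_test_differential : chart_cod c x ->
  @differential R H M X global_test (chart_inv c x) \o to_tangent X c x = B v.
Proof.
move=> cod_x; set m := chart_inv c x; pose k := chart_at X m.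
have Xc : atlas X c by exact: chart_at_atlas.
have Xk : atlas X k by exact: chart_at_atlas.
have dom_m : chart_dom c m by exact: chart_inv_dom.
have k_m : chart_dom k m by exact: chart_at_dom.
have cod_km : chart_cod k (chart_map k m) by exact: chart_map_cod.
have d1 := (C1_mderiv (global_test_C1 Xk) cod_km).1.
have d2 := to_tangent_frechet Xc cod_x.
have := frechet_comp d2 d1; rewrite -/m -/k => d12.
have d3 := frechet_translate (frechet_test hB v s (x - x)).
rewrite subrr (test_grad0 hB) in d3.
apply: frechet_unique d3.
apply: frechet_near d12.
apply: filterS2 (chart_cod_near cod_x) (chart_inv_near cod_x (chart_dom_near k_m)).
move=> y cod_y k_y; rewrite /= chart_mapK // global_test_dom ?chart_invK //.
exact: chart_inv_dom.
Qed.

End GlobalTest.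

(** Near the point, the test function is a minorant of f up to a constant, so
    the bound on the subdifferential applies to its differential, which is B v
    in the chart c. *)
Lemma proximal_bound (f : M -> R) (K : R) (K_ge0 : 0 <= K)
    (f_sub : forall (p : M) (zeta : tangent X p -> R),
       subdifferential X f p zeta -> (conorm g zeta <= K%:E)%E) (p : M) :
  \forall x \near chart_map (chart_at X p) p, forall v s,
    (\forall w \near 0, f (chart_inv (chart_at X p) x) + metric_at g p v w -
        s * metric_at g p w w <= f (chart_inv (chart_at X p) (x + w))) ->
    forall w, `|metric_at g p v w| <=
      K * Num.sqrt (chart_metric g (chart_at X p) x w w).
Proof.
set c := chart_at X p; set B := metric_at g p.
have [a [b hB]] := metric_equivalent g p.
have a0 : 0 < a by case: hB.
have Xc : atlas X c by exact: chart_at_atlas.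
have cod0 : chart_cod c (chart_map c p) by apply: chart_map_cod; exact: chart_at_dom.
have [r1 r10 hr1] := closed_chart_image g M_hausdorff p.
have /nbhs_ballP[r2 /= r20 hr2] := chart_cod_near cod0.
pose r := Num.min r1 r2 / 2.
have m0 : 0 < Num.min r1 r2 by rewrite lt_min r10.
have r0 : 0 < r by rewrite divr_gt0.
have rr1 : r + r <= r1 by rewrite /r -splitr ge_min lexx.
have rr2 : r + r <= r2 by rewrite /r -splitr ge_min lexx orbT.
pose rho := a * r / 2.
have rho0 : 0 < rho by rewrite divr_gt0 // mulr_gt0.
apply/nbhs_ballP; exists r => //= x; rewrite -ball_normE /= distrC => xr v s prox w.
have supp y : inorm B (y - x) <= rho -> `|y - chart_map c p| < r + r.
  move=> Ny; rewrite -(subrK x y) -addrA; apply: le_lt_trans (ler_normD _ _) _.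
  apply: ltrD => //; rewrite -(ltr_pM2l a0); apply: le_lt_trans (inorm_lower hB _) _.
  apply: le_lt_trans Ny _; rewrite /rho.
  by have := mulr_gt0 a0 r0; lra.
pose s' := `|s| + (inorm B v + 1) ^+ 2 / 2 + (rho ^- 2 + inorm B v / rho).
have Nv := inorm_ge0 B v.
have h1 : 0 <= (inorm B v + 1) ^+ 2 / 2 by rewrite divr_ge0 // sqr_ge0.
have h2 : 0 < rho ^- 2 by rewrite invr_gt0 exprn_gt0.
have h3 : 0 <= inorm B v / rho by rewrite divr_ge0 // ltW.
have s'_ge : rho ^- 2 + inorm B v / rho <= s'.
  by rewrite /s'; have := normr_ge0 s; lra.
have s'_le : s + (inorm B v + 1) ^+ 2 / 2 <= s'.
  by rewrite /s'; have := ler_norm s; lra.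
have supp_cod y : inorm B (y - x) <= rho -> chart_cod c y.
  move=> /supp yr; apply: hr2; rewrite -ball_normE /= distrC.
  exact: lt_le_trans yr rr2.
have supp_closed : closed (chart_inv c @` [set y | inorm B (y - x) <= rho]).
  apply: hr1; first exact: inorm_ball_closed hB _ _.
  by move=> y /supp /ltW /le_trans; apply.
have cod_x : chart_cod c x.
  by apply: supp_cod; rewrite subrr (inorm0 hB) ltW.
pose phi := global_test p x v s'.
have phi_C1 : C1_function X phi := global_test_C1 hB rho0 s'_ge supp_cod supp_closed.
set m := chart_inv c x in prox *.
have dom_m : chart_dom c m by exact: chart_inv_dom.
have sub : subdifferential X f m (@differential R H M X phi m).
  exists phi; split=> //.
  pose W y := f m + B v (y - x) - s * B (y - x) (y - x)
      <= f (chart_inv c (x + (y - x))) /\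
    test_fun B v s' (y - x) <= 2^-1 + (B v (y - x) - s * B (y - x) (y - x)).
  have near_x : \forall y \near x, W y.
    rewrite (near_shift 0) /=.
    apply: filterS2 prox (test_fun_le hB s'_le) => y h4 h5.
    by rewrite /W /= subr0 addrK.
  have near_m : \forall q \near m, W (chart_map c q).
    by apply: (@chart_map_near _ _ _ c m W dom_m); rewrite chart_invK.
  apply: filterS2 (chart_dom_near dom_m) near_m => q dom_q [].
  rewrite [x + _]addrC subrK chart_mapK // => f_q phi_q.
  rewrite /phi !global_test_dom // chart_invK // subrr (test_fun0 hB).
  move: f_q phi_q; rewrite -/c; lra.
have lin_diff : linear (@differential R H M X phi m : H -> R^o) by move=> *; exact: linearP.
have := conorm_le lin_diff K_ge0 (f_sub _ _ sub) (to_tangent X c x w).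
have /(congr1 (fun D => D w)) /= :=
  global_test_differential hB rho0 s'_ge supp_cod supp_closed cod_x.
by rewrite -/phi -/m => ->.
Qed.

End Subgradients.

(** * Integrating a local growth bound *)

Section DiniIntegral.
Variables (R : realType).
Local Notation mu := (@lebesgue_measure R).
Variables (h v : R -> R).
Hypothesis v_cont : {within `[0, 1], continuous v}.
Hypothesis v_ge0 : forall t : R, 0 <= t <= 1 -> 0 <= v t.
Hypothesis h_dini : forall t : R, 0 <= t <= 1 -> forall e : R, 0 < e ->
  \forall s \near t, 0 <= s <= 1 -> `|h s - h t| <= (v t + e) * `|s - t|.

(** Adding d to v leaves room for two errors of d / 2, that of the growth bound
    at t and the variation of v near t; the resulting inequality between h and
    the integral of v + d is local and additive, hence can be chained. *)
Lemma dini_integral : (`|h 1 - h 0|%:E <= \int[mu]_(x in `[0%R, 1%R]) (v x)%:E)%E.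
Proof.
apply/lee_addgt0Pr => d d0.
pose F x : \bar R := (v x + d)%:E.
have mv : measurable_fun (`[0, 1] : set R) v by exact: subspace_continuous_measurable_fun.
have mF : measurable_fun (`[0, 1] : set R) F.
  by apply/measurable_EFinP; apply: measurable_funD => //; exact: measurable_cst.
have F0 x : 0 <= x <= 1 -> (0 <= F x)%E.
  by move=> /v_ge0 vx; rewrite lee_fin addr_ge0 // ltW.
have mFs (s t : R) : 0 <= s -> t <= 1 -> measurable_fun (`]s, t] : set R) F.
  move=> s0 t1; apply: measurable_funS mF => // x /=; rewrite !in_itv /= => /andP[sx xt].
  by rewrite (le_trans s0 (ltW sx)) (le_trans xt).
have lower (s t k : R) : 0 <= s -> s <= t -> t <= 1 -> 0 <= k ->
    (forall x, s <= x <= t -> k <= v x + d) ->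
    ((k * (t - s))%:E <= \int[mu]_(x in `]s, t]) F x)%E.
  move=> s0 st t1 k0 kF.
  apply: (@le_trans _ _ (\int[mu]_(x in `]s, t]) (cst k%:E) x)%E).
    rewrite integral_cst //= lebesgue_measure_itv /= lte_fin.
    case: ltP => [_|ts]; first by rewrite -EFinB -EFinM.
    have -> : s = t by apply/le_anti; rewrite st ts.
    by rewrite subrr mulr0 mule0.
  apply: ge0_le_integral => //=; first exact: mFs.
  by move=> x; rewrite /= in_itv /= => /andP[sx xt]; rewrite lee_fin kF // ltW.
have chain : (`|h 1 - h 0|%:E <= \int[mu]_(x in `]0%R, 1%R]) F x)%E.
  apply: (@interval_chain R (fun s t : R => (
    `|h t - h s|%:E <= \int[mu]_(x in `]s, t]) F x)%E) 0 1) => //.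
    move=> s t t' s0 st tt' t'1 hst htt'.
    have -> : `]s, t']%classic = `]s, t]%classic `|` `]t, t']%classic :> set R.
      by rewrite -itv_bndbnd_setU // bnd_simp.
    rewrite ge0_integral_setU //=.
    - apply: le_trans (leeD hst htt'); rewrite -EFinD lee_fin.
      by rewrite [leRHS]addrC; exact: ler_distD.
    - rewrite -itv_bndbnd_setU ?bnd_simp //; exact: mFs.
    - move=> x; rewrite /= !in_itv /= => xx; apply: F0.
      case: xx => /andP[h1 h2].
        by rewrite (le_trans s0 (ltW h1)) (le_trans h2 (le_trans tt' t'1)).
      by rewrite (le_trans s0 (le_trans st (ltW h1))) (le_trans h2 t'1).
    - rewrite disj_set2E; apply/eqP; apply/seteqP; split => x //=.
      by rewrite !in_itv /= => -[/andP[_ xt] /andP[tx _]]; move: xt; rewrite leNgt tx.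
  move=> t t01; have [t0 t1] := andP t01.
  have d2 : 0 < d / 2 by rewrite divr_gt0.
  have near_v : \forall s \near t, 0 <= s <= 1 -> v t - d / 2 <= v s.
    have /subspace_continuousP/(_ t) := v_cont.
    rewrite /= in_itv /= => /(_ t01)/cvgrPdist_le/(_ _ d2).
    rewrite near_withinE; apply: filterS => s hs s01.
    have := hs; rewrite /= in_itv /= => /(_ s01); rewrite ler_norml => /andP[_].
    by rewrite /from_subspace; lra.
  have k0 : 0 <= v t + d / 2 by rewrite addr_ge0 ?v_ge0 // ltW.
  have /nbhs_ballP[r /= r0 hr] : \forall s \near t,
      (0 <= s <= 1 -> v t - d / 2 <= v s) /\
      (0 <= s <= 1 -> `|h s - h t| <= (v t + d / 2) * `|s - t|).
    by apply: filterS2 near_v (h_dini t01 d2).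
  apply/nbhs_ballP; exists r => //= s; rewrite -ball_normE /= => sr.
  have near_bound x : `|t - x| <= `|t - s| -> 0 <= x <= 1 -> v t + d / 2 <= v x + d.
    move=> xs x01; have [|+ _] := hr x; first by rewrite -ball_normE /= (le_lt_trans xs).
    by move=> /(_ x01); lra.
  have [|_ hst] := hr s; first by rewrite -ball_normE.
  split => /andP[h1 h2].
    apply: le_trans (lower s t (v t + d / 2) h1 h2 t1 k0 _).
      rewrite lee_fin distrC; apply: le_trans (hst _) _.
        by rewrite h1 (le_trans h2).
      by rewrite distrC ger0_norm // subr_ge0.
    move=> x /andP[sx xt]; apply: near_bound; last by rewrite (le_trans h1 sx) (le_trans xt).
    by rewrite !ger0_norm ?subr_ge0 // lerD2l lerN2.
  apply: le_trans (lower t s (v t + d / 2) t0 h1 h2 k0 _).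
    rewrite lee_fin; apply: le_trans (hst _) _; first by rewrite h2 (le_trans t0).
    by rewrite ger0_norm // subr_ge0.
  move=> x /andP[tx xs]; apply: near_bound; last by rewrite (le_trans t0 tx) (le_trans xs).
  by rewrite !(distrC t) !ger0_norm ?subr_ge0 ?lerD2r.
apply: le_trans chain _.
apply: (@le_trans _ _ (\int[mu]_(x in `[0%R, 1%R]) F x)%E).
  apply: ge0_subset_integral => //.
  by move=> x /=; rewrite !in_itv /= => /andP[/ltW -> ->].
rewrite (@eq_integral _ _ _ mu _ (fun x => (v x)%:E + cst d%:E x)%E) //.
rewrite ge0_integralD //=.
- rewrite integral_cst //= lebesgue_measure_itv /= lte_fin ltr01.
  by rewrite oppr0 adde0 mule1.
- by apply/measurable_EFinP.
- by move=> x _; rewrite lee_fin ltW.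
Qed.
End DiniIntegral.

(** * Velocity and speed of a path *)

Section UnitCurves.
Variables (R : realType) (H : completeNormedModType R).
Implicit Types (u : R -> H) (t : R) (w : H).

(** The convergence of difference quotients, in the form that can be composed
    with a differentiable map. *)
Definition unit_expand u t w := forall e : R, 0 < e ->
  \forall s \near t, 0 <= s <= 1 -> `|u s - u t - (s - t) *: w| <= e * `|s - t|.

Lemma unit_quotientP u t w :
  unit_quotient u t --> w <-> unit_expand u t w.
Proof.
have key s : s != t ->
    `|u s - u t - (s - t) *: w| = `|s - t| * `|w - (s - t)^-1 *: (u s - u t)|.
  move=> st; rewrite -normrZ scalerBr scalerA mulfV ?subr_eq0 // scale1r.
  by rewrite -normrN opprB.
split=> [/cvgrPdist_le uw e e0|uw].
  have := uw _ e0; rewrite !near_withinE; apply: filterS => s hs s01.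
  have [->|st] := eqVneq s t; first by rewrite !subrr scale0r subrr !normr0 mulr0.
  by rewrite key // mulrC ler_wpM2r // hs //= in_itv.
apply/cvgrPdist_le => e e0; rewrite !near_withinE.
have := uw _ e0; apply: filterS => s hs st; rewrite /= in_itv => /hs.
rewrite key // mulrC ler_pM2r // normr_gt0 subr_eq0 //.
Qed.

(** Every point of [0, 1] is a limit of other points of [0, 1], so limits of
    difference quotients are unique. *)
Lemma unit_within_proper t : 0 <= t <= 1 -> ProperFilter (within `[0, 1] t^').
Proof.
move=> /andP[t0 t1]; apply: Build_ProperFilter_ex => P.
rewrite /within /= /dnbhs /within /= => /nbhs_ballP[e /= e0 he].
pose d := Num.min (e / 2) 2^-1.
have d0 : 0 < d by rewrite lt_min divr_gt0 //= invr_gt0.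
have de : d < e.
  by apply: (@le_lt_trans _ _ (e / 2)); [rewrite ge_min lexx | lra].
have d1 : d <= 2^-1 by rewrite ge_min lexx orbT.
have [th|th] := leP t 2^-1.
  exists (t + d); apply: (he (t + d)).
  - by rewrite -ball_normE /= opprD addNKr normrN gtr0_norm.
  - by rewrite -subr_eq0 addrC addKr gt_eqF.
  - by rewrite in_itv /=; apply/andP; split; lra.
exists (t - d); apply: (he (t - d)).
- by rewrite -ball_normE /= opprB addrC subrK gtr0_norm.
- by rewrite -subr_eq0 addrC addKr oppr_eq0 gt_eqF.
- by rewrite in_itv /=; apply/andP; split; lra.
Qed.

Lemma unit_quotient_lim u t w : 0 <= t <= 1 -> unit_expand u t w ->
  lim (unit_quotient u t) = w.
Proof.
move=> t01 /unit_quotientP uw; have pf := unit_within_proper t01.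
by apply: cvg_lim uw; exact: norm_hausdorff.
Qed.

Lemma unit_expand_lipschitz u t w : unit_expand u t w ->
  \forall s \near t, 0 <= s <= 1 -> `|u s - u t| <= (`|w| + 1) * `|s - t|.
Proof.
move=> /(_ 1 ltr01); apply: filterS => s hs /hs h.
rewrite -(subrK ((s - t) *: w) (u s - u t)); apply: le_trans (ler_normD _ _) _.
by rewrite normrZ; lra.
Qed.

Lemma unit_expand_near u t w (Q : H -> Prop) : unit_expand u t w ->
  (\forall y \near u t, Q y) -> \forall s \near t, 0 <= s <= 1 -> Q (u s).
Proof.
move=> /unit_expand_lipschitz lip /nbhs_ballP[e /= e0 he].
have w1 : 0 < `|w| + 1 by rewrite ltr_wpDl.
have ew : 0 < e / (`|w| + 1) by rewrite divr_gt0.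
near=> s => s01; apply: he; rewrite -ball_normE /= distrC.
have h1 : `|u s - u t| <= (`|w| + 1) * `|s - t| by move: s01; near: s.
apply: le_lt_trans h1 _; rewrite mulrC -ltr_pdivlMr // distrC.
Unshelve. all: by end_near. Qed.

Lemma unit_expand_comp u t w (tau : H -> H) D :
  unit_expand u t w -> frechet tau (u t) D -> unit_expand (tau \o u) t (D w).
Proof.
move=> uw [linD [C DC] tauD] e e0.
have w1 : 0 < `|w| + 1 by rewrite ltr_wpDl.
have C1 : 0 < `|C| + 1 by rewrite ltr_wpDl.
have e1 : 0 < e / 2 / (`|w| + 1) by rewrite !divr_gt0.
have e2 : 0 < e / 2 / (`|C| + 1) by rewrite !divr_gt0.
near=> s => s01.
have h1 : `|u s - u t| <= (`|w| + 1) * `|s - t|.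
  by move: s01; near: s; exact: unit_expand_lipschitz.
have h2 : `|tau (u s) - tau (u t) - D (u s - u t)| <=
    e / 2 / (`|w| + 1) * `|u s - u t|.
  by move: s01; near: s; exact: unit_expand_near uw (tauD _ e1).
have h3 : `|u s - u t - (s - t) *: w| <= e / 2 / (`|C| + 1) * `|s - t|.
  by move: s01; near: s; exact: uw.
have D0 : D 0 = 0.
  by have := linD (-1) 0 0; rewrite scaler0 addr0 scaleN1r addNr.
have DB : D (u s - u t - (s - t) *: w) = D (u s - u t) - (s - t) *: D w.
  by rewrite addrC -scaleNr linD scaleNr addrC.
have -> : (tau \o u) s - (tau \o u) t - (s - t) *: D w =
    (tau (u s) - tau (u t) - D (u s - u t)) + D (u s - u t - (s - t) *: w).
  by rewrite DB addrA subrK.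
apply: le_trans (ler_normD _ _) _; rewrite (splitr e) mulrDl; apply: lerD.
  apply: le_trans h2 _; apply: le_trans (ler_wpM2l (ltW e1) h1) _.
  by rewrite mulrA divfK // gt_eqF.
apply: le_trans (DC _) _.
apply: (@le_trans _ _ ((`|C| + 1) * `|u s - u t - (s - t) *: w|)).
  by rewrite ler_wpM2r // (le_trans (ler_norm _)) // lerDl.
apply: le_trans (ler_wpM2l (ltW C1) h3) _.
by rewrite mulrA [X in X * _]mulrC divfK // gt_eqF.
Unshelve. all: by end_near. Qed.

Lemma unit_expand_eq u u' t w : 0 <= t <= 1 ->
  (\forall s \near t, 0 <= s <= 1 -> u s = u' s) ->
  unit_expand u t w -> unit_expand u' t w.
Proof.
move=> t01 uu' uw e e0.
have ut := nbhs_singleton uu' t01.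
apply: filterS2 uu' (uw _ e0) => s us hs s01.
by rewrite -(us s01) -ut; exact: hs.
Qed.

End UnitCurves.

Section Speed.
Variables (R : realType) (H : completeNormedModType R) (M : topologicalType).
Variables (X : smooth_structure H M) (g : riemannian_metric X).
Variable gamma : R -> M.
Hypothesis gamma_C1 : C1_path X gamma.

Definition speed (t : R) : R := tnorm g (velocity X gamma t).

Lemma path_near (t : R) (V : M -> Prop) : 0 <= t <= 1 ->
  (\forall m \near gamma t, V m) -> \forall s \near t, 0 <= s <= 1 -> V (gamma s).
Proof.
move=> t01 Vt; have [/subspace_continuousP/(_ t) + _] := gamma_C1.
rewrite /= in_itv /= => /(_ t01) gamma_t.
have : \forall s \near within `[0, 1] (nbhs t), V (gamma s) by exact: gamma_t _ Vt.
rewrite near_withinE; apply: filterS => s hs s01.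
by apply: hs; rewrite /= in_itv.
Qed.

(** The velocity is computed in the preferred chart of gamma t, which changes
    with t; the chain rule expresses it in one chart around the point. *)
Lemma velocity_chart c t w : atlas X c -> 0 <= t <= 1 -> chart_dom c (gamma t) ->
  unit_expand (chart_map c \o gamma) t w ->
  velocity X gamma t = to_tangent X c (chart_map c (gamma t)) w.
Proof.
move=> Xc t01 dom_t uw; apply: unit_quotient_lim => //.
have cod_t : chart_cod c (chart_map c (gamma t)) by exact: chart_map_cod.
have := unit_expand_comp uw (to_tangent_frechet Xc cod_t).
rewrite chart_mapK //; apply: unit_expand_eq => //.
apply: filterS (path_near t01 (chart_dom_near dom_t)) => s hs s01.
by rewrite /= chart_mapK //; exact: hs.
Qed.

Lemma speed_chart c t w : atlas X c -> 0 <= t <= 1 -> chart_dom c (gamma t) ->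
  unit_expand (chart_map c \o gamma) t w ->
  speed t = Num.sqrt (chart_metric g c (chart_map c (gamma t)) w w).
Proof.
move=> Xc t01 dom_t uw; rewrite /chart_metric chart_mapK //.
by rewrite -(velocity_chart Xc t01 dom_t uw).
Qed.

(** In a fixed chart c, the speed is the square root of the metric evaluated at
    the derivative of the curve.  The metric is continuous in operator norm, so
    it may be frozen at gamma t up to an error proportional to the squared norm
    of the derivative. *)
Lemma speed_continuous : {within `[0, 1], continuous speed}.
Proof.
apply/subspace_continuousP => t; rewrite /= in_itv /= => t01.
change (speed @ within `[0, 1] (nbhs t) --> speed t).
set c := chart_at X (gamma t).
have Xc : atlas X c by exact: chart_at_atlas.
have dom_t : chart_dom c (gamma t) by exact: chart_at_dom.
have cod_t : chart_cod c (chart_map c (gamma t)) by exact: chart_map_cod.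
have [a [b hB]] := metric_equivalent g (gamma t).
have [_ /(_ c Xc) [w [Dw /subspace_continuousP cw]]] := gamma_C1.
have dom_near := path_near t01 (chart_dom_near dom_t).
have w_cvg : w @ within `[0, 1] (nbhs t) --> w t.
  apply/cvgrPdist_le => e e0.
  have It : (`[0, 1] `&` gamma @^-1` chart_dom c) t by split; rewrite /= ?in_itv.
  have /cvgrPdist_le/(_ _ e0) := cw t It.
  rewrite !near_withinE.
  apply: filterS2 dom_near => s ds ws s01; rewrite /= in_itv /= in s01.
  by apply: ws; split; [rewrite /= in_itv | exact: ds].
have uw s : 0 <= s <= 1 -> chart_dom c (gamma s) ->
    unit_expand (chart_map c \o gamma) s (w s).
  by move=> s01 ds; apply/unit_quotientP; apply: Dw; split => //; rewrite /= in_itv.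
pose Q s := chart_metric g c (chart_map c (gamma s)) (w s) (w s).
have Q_cvg : Q @ within `[0, 1] (nbhs t) --> Q t.
  apply/cvgrPdist_le => e e0.
  have w1 : 0 < `|w t| + 1 by rewrite ltr_wpDl.
  have e1 : 0 < e / 2 / (`|w t| + 1) ^+ 2 by rewrite !divr_gt0 ?exprn_gt0.
  have e2 : 0 < e / 2 by rewrite divr_gt0.
  have Bw : (fun s => metric_at g (gamma t) (w s) (w s)) @ within `[0, 1] (nbhs t)
      --> metric_at g (gamma t) (w t) (w t) by exact: (form_cvg hB w_cvg w_cvg).
  have /cvgrPdist_le/(_ _ e2) Bnear := Bw.
  have /cvgrPdist_le/(_ _ ltr01) wnear := w_cvg.
  have Gnear : \forall s \near within `[0, 1] (nbhs t), forall v v',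
      `|chart_metric g c (chart_map c (gamma s)) v v' -
        chart_metric g c (chart_map c (gamma t)) v v'| <=
        e / 2 / (`|w t| + 1) ^+ 2 * `|v| * `|v'|.
    rewrite near_withinE; have := unit_expand_near (uw t t01 dom_t)
      (chart_metric_near g Xc cod_t e1).
    by apply: filterS => s hs; rewrite /= in_itv; exact: hs.
  apply: filterS3 Bnear wnear Gnear => s hB' hw /(_ (w s) (w s)).
  rewrite -/(Q s) chart_metric_at => hG.
  have ws : `|w s| <= `|w t| + 1.
    rewrite -(subrK (w t) (w s)) addrC; apply: le_trans (ler_normD _ _) _.
    by rewrite lerD2l distrC.
  have hG2 : e / 2 / (`|w t| + 1) ^+ 2 * `|w s| * `|w s| <= e / 2.
    apply: (@le_trans _ _ (e / 2 / (`|w t| + 1) ^+ 2 * (`|w t| + 1) ^+ 2)).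
      by rewrite -mulrA ler_wpM2l ?(ltW e1) // expr2 ler_pM.
    by rewrite divfK // expf_neq0 // gt_eqF.
  rewrite /Q chart_metric_at -/(Q s).
  apply: le_trans (ler_distD (metric_at g (gamma t) (w s) (w s)) _ _) _.
  rewrite (splitr e); apply: lerD => //.
  by rewrite distrC (le_trans hG).
have sqrtQ : (Num.sqrt \o Q) @ within `[0, 1] (nbhs t) --> Num.sqrt (Q t).
  by apply: cvg_comp Q_cvg _; exact: sqrt_continuous.
have -> : speed t = Num.sqrt (Q t) by apply: speed_chart; last exact: uw.
apply: cvg_trans sqrtQ; apply: near_eq_cvg.
rewrite near_withinE; apply: filterS dom_near => s ds.
rewrite /= in_itv /= => s01.
by rewrite (speed_chart Xc s01 (ds s01) (uw _ s01 (ds s01))).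
Qed.

Lemma speed_ge0 t : 0 <= speed t. Proof. exact: sqrtr_ge0. Qed.

End Speed.

(** * The Lipschitz estimate *)

Section LipschitzBound.
Variables (R : realType) (H : completeNormedModType R) (M : topologicalType).
Hypothesis M_hausdorff : hausdorff_space M.
Variables (X : smooth_structure H M) (g : riemannian_metric X) (f : M -> R).
Hypothesis f_lsc : lower_semicontinuous (fun p : M => (f p)%:E).
Variable K : R.
Hypothesis K_gt0 : 0 < K.
Hypothesis f_sub : forall (p : M) (zeta : tangent X p -> R),
  subdifferential X f p zeta -> (conorm g zeta <= K%:E)%E.

(** With L between K and K', the norm given by the metric near p is at most
    L / K times the norm at p, so quadratic minorants of f in the chart have slope at most L
    for the norm of the tangent space at p. *)
Lemma chart_lipschitz p K' : K < K' -> exists C,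
  \forall x \near chart_map (chart_at X p) p,
    `|f (chart_inv (chart_at X p) x) - f p| <=
    K' * inorm (metric_at g p) (x - chart_map (chart_at X p) p) +
    C * inorm (metric_at g p) (x - chart_map (chart_at X p) p) ^+ 2.
Proof.
move=> KK'; set c := chart_at X p; set x0 := chart_map c p.
have [a [b hB]] := metric_equivalent g p.
have cod0 : chart_cod c x0 by apply: chart_map_cod; exact: chart_at_dom.
have inv0 : chart_inv c x0 = p by rewrite chart_mapK //; exact: chart_at_dom.
pose L := (K + K') / 2.
have KL : K < L by rewrite /L; lra.
have LK' : L < K' by rewrite /L; lra.
have LK1 : 1 < L / K by rewrite ltr_pdivlMr // mul1r.
have lsc_m (m : M) (d : R) : 0 < d -> \forall q \near m, f m - d < f q.
  move=> d0; have [|V Vm hV] := @f_lsc m (f m - d) _.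
    by rewrite lte_fin ltrBlDr ltrDl.
  by apply: filterS Vm => q /hV; rewrite lte_fin.
have lsc_y y : chart_cod c y -> forall d : R, 0 < d ->
    \forall y' \near y, f (chart_inv c y) - d < f (chart_inv c y').
  move=> cy d d0; exact: chart_inv_near cy (lsc_m _ _ d0).
have /nbhs_ballP[r /= r0 hr] : \forall x \near x0, [/\ chart_cod c x,
    f p - 1 < f (chart_inv c x),
    forall w, Num.sqrt (chart_metric g c x w w) <= L / K * inorm (metric_at g p) w
    & forall v s, (\forall w \near 0, f (chart_inv c x) + metric_at g p v w -
        s * metric_at g p w w <= f (chart_inv c (x + w))) ->
    forall w, `|metric_at g p v w| <= K * Num.sqrt (chart_metric g c x w w)].
  have h1 := chart_cod_near cod0.
  have h2 := lsc_y _ cod0 _ ltr01; rewrite inv0 in h2.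
  have h3 := chart_norm_near g p LK1.
  have h4 := proximal_bound M_hausdorff (ltW K_gt0) f_sub p.
  near=> x; split.
  - by near: x.
  - by near: x.
  - by near: x.
  - by near: x.
have in_ball x : `|x - x0| < r -> ball x0 r x by rewrite -ball_normE /= distrC.
have -> : f p = (f \o chart_inv c) x0 by rewrite /= inv0.
apply: (@local_lipschitz _ _ _ _ _ hB (f \o chart_inv c) x0 r (f p - 1) L K') => //.
- by move=> y /in_ball/hr[cy _ _ _]; exact: lsc_y.
- by move=> y /in_ball/hr[_ /ltW].
- move=> x v s /in_ball/hr[_ _ hx hprox] prox w.
  apply: le_trans (hprox v s prox w) _.
  apply: le_trans (ler_wpM2l (ltW K_gt0) (hx w)) _.
  by rewrite mulrA mulrCA divff ?mulr1 // gt_eqF.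
- by rewrite ltW // (lt_trans K_gt0).
Unshelve. all: by end_near. Qed.

(** In the chart around gamma t, the increment of the curve has norm at most
    (speed + eta) |s - t| for the metric at gamma t.  Besides K * speed, the
    slope has three contributions: from K' - K, from eta and from the quadratic
    term.  Each of them is made at most e / 4. *)
Lemma path_dini (gamma : R -> M) (t e : R) : C1_path X gamma -> 0 <= t <= 1 -> 0 < e ->
  \forall s \near t, 0 <= s <= 1 ->
    `|f (gamma s) - f (gamma t)| <= (K * speed g gamma t + e) * `|s - t|.
Proof.
move=> gammaC t01 e0; set c := chart_at X (gamma t).
have Xc : atlas X c by exact: chart_at_atlas.
have dom_t : chart_dom c (gamma t) by exact: chart_at_dom.
have [a [b hB]] := metric_equivalent g (gamma t).
have b0 : 0 < b by case: hB.
have [_ /(_ c Xc) [w_ [Dw _]]] := gammaC.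
set w := w_ t.
have uw : unit_expand (chart_map c \o gamma) t w.
  by apply/unit_quotientP; apply: Dw; split; rewrite /= ?in_itv.
set N := inorm (metric_at g (gamma t)).
have speedE : speed g gamma t = N w.
  rewrite (speed_chart g gammaC Xc t01 dom_t uw) /N /inorm.
  by congr (Num.sqrt _); exact: chart_metric_at.
have Nw : 0 <= N w by exact: inorm_ge0.
have Nw1 : 0 < N w + 1 by rewrite ltr_wpDl.
pose k := e / 4 / (N w + 1).
have k0 : 0 < k by rewrite !divr_gt0.
pose K' := K + k.
have KK' : K < K' by rewrite ltrDl.
have K'0 : 0 < K' by rewrite (lt_trans K_gt0).
have [C hC] := chart_lipschitz (gamma t) KK'.
pose eta := e / 4 / K'.
have eta0 : 0 < eta by rewrite !divr_gt0.
pose A := N w + eta.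
have A0 : 0 < A by rewrite ltr_wpDl.
have C1 : 0 < `|C| + 1 by rewrite ltr_wpDl.
pose d := e / 4 / ((`|C| + 1) * A ^+ 2).
have A2 : 0 < A ^+ 2 by rewrite exprn_gt0.
have d0 : 0 < d by rewrite divr_gt0 ?divr_gt0 // mulr_gt0.
have etab : 0 < eta / b by rewrite divr_gt0.
have dom_near := path_near gammaC t01 (chart_dom_near dom_t).
have est_near := unit_expand_near uw hC.
near=> s => s01.
have ds : chart_dom c (gamma s) by move: s01; near: s; exact: dom_near.
have hs : `|f (gamma s) - f (gamma t)| <=
    K' * N (chart_map c (gamma s) - chart_map c (gamma t)) +
    C * N (chart_map c (gamma s) - chart_map c (gamma t)) ^+ 2.
  rewrite -[X in f X](chart_mapK ds).
  by move: s01; near: s; exact: est_near.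
have exps : `|chart_map c (gamma s) - chart_map c (gamma t) - (s - t) *: w|
    <= eta / b * `|s - t|.
  by move: s01; near: s; exact: uw.
have st : `|s - t| <= d.
  by rewrite distrC; near: s; apply: cvgr_dist_le => //; exact: cvg_id.
set y := chart_map c (gamma s) - chart_map c (gamma t) in hs exps.
have Ny : N y <= A * `|s - t|.
  rewrite -(subrK ((s - t) *: w) y); apply: le_trans (inormD hB _ _) _.
  rewrite (inormZ hB) /A mulrDl addrC lerD //; first by rewrite mulrC.
  apply: le_trans (inorm_upper hB _) _.
  apply: le_trans (ler_wpM2l (ltW b0) exps) _.
  by rewrite mulrA mulrCA divff ?mulr1 // gt_eqF.
have Ny0 : 0 <= N y by exact: inorm_ge0.
apply: le_trans hs _.
apply: (@le_trans _ _ (K' * (A * `|s - t|) + (`|C| + 1) * (A * `|s - t|) ^+ 2)).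
  apply: lerD; first by rewrite ler_pM2l.
  apply: (@le_trans _ _ ((`|C| + 1) * N y ^+ 2)).
    by rewrite ler_wpM2r ?sqr_ge0 // (le_trans (ler_norm _)) // lerDl.
  by rewrite ler_pM2l // lerXn2r // nnegrE // mulr_ge0 // ltW.
have -> : K' * (A * `|s - t|) + (`|C| + 1) * (A * `|s - t|) ^+ 2 =
    (K' * A + (`|C| + 1) * A ^+ 2 * `|s - t|) * `|s - t| by ring.
rewrite speedE ler_wpM2r //.
have h1 : (`|C| + 1) * A ^+ 2 * `|s - t| <= e / 4.
  by rewrite mulrC -ler_pdivlMr // mulr_gt0.
have h2 : K' * eta = e / 4 by rewrite mulrC divfK // gt_eqF.
have h3 : k * N w <= e / 4.
  apply: (@le_trans _ _ (k * (N w + 1))); first by rewrite ler_pM2l // lerDl.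
  by rewrite divfK // gt_eqF.
have -> : K' * A = K * N w + k * N w + e / 4 by rewrite mulrDr h2 -mulrDl.
lra.
Unshelve. all: by end_near. Qed.

Lemma path_length_bound (gamma : R -> M) : C1_path X gamma ->
  (`|f (gamma 1) - f (gamma 0)|%:E <= K%:E * path_length g gamma)%E.
Proof.
move=> gammaC; have cs := speed_continuous (g := g) gammaC.
have -> : (K%:E * path_length g gamma = \int[lebesgue_measure]_(t in `[0%R, 1%R])
    (K * speed g gamma t)%:E)%E.
  rewrite /path_length -ge0_integralZl_EFin //=; last exact: ltW.
  - by move=> x _; rewrite lee_fin; exact: sqrtr_ge0.
  - by apply/measurable_EFinP; exact: subspace_continuous_measurable_fun.
apply: (@dini_integral R (f \o gamma) (fun t => K * speed g gamma t)).
- by move=> x; apply: cvgMr; exact: cs.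
- by move=> t _; rewrite mulr_ge0 ?(ltW K_gt0) // speed_ge0.
- by move=> t t01 e e0; exact: path_dini.
Qed.

End LipschitzBound.

Theorem theorem4p18 (R : realType) (H : completeNormedModType R)
    (H_hilbert : hilbertian H) (M : topologicalType)
    (M_hausdorff : hausdorff_space M) (X : smooth_structure H M)
    (g : riemannian_metric X) (f : M -> R)
    (f_lsc : lower_semicontinuous (fun p : M => (f p)%:E))
    (K : R) (K_gt0 : 0 < K)
    (f_sub : forall (p : M) (zeta : tangent X p -> R),
       subdifferential X f p zeta -> (conorm g zeta <= K%:E)%E) :
  forall p q : M, ((`|f p - f q|)%:E <= K%:E * riemannian_dist g p q)%E.
Proof.
move=> p q; rewrite -lee_pdivrMl //.
apply: le_ereal_inf_tmp => _ [gamma [gammaC g0 g1] <-].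
rewrite lee_pdivrMl // distrC -g0 -g1.
exact: path_length_bound.
Qed.
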